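(* Let $V$, $W$, $U$ be irreducible finite-dimensional representations of $\mathfrak{gl}_n$ over $\mathbb{C}$ with non-negative integer highest weights $[m_1,\dots,m_n]$, $[M_1,\dots,M_n]$, $[m'_1,\dots,m'_n]$, and let $V\otimes W\otimes U$ be realized as a space of polynomials in the matrix elements $a_i^j,b_i^j,c_i^j$ (functional realization). Every semi-invariant in $V\otimes W\otimes U$ is a linear combination of semi-invariants constructed as follows. Take a monomial in $a_i^j,b_i^j,c_i^j$ such that, among its factors that are symbols $a$, the upper index $k$ occurs exactly $m_k$ times for every $k=1,\dots,n$, among its factors that are symbols $b$ the upper index $k$ occurs exactly $M_k$ times, and among its factors that are symbols $c$ the upper index $k$ occurs exactly $m'_k$ times. Divide the lower indices of the monomial into non-intersecting groups consisting of $n$ indices each. Overlay the three Young symmetrizers (for the symbols $a$, $b$, $c$) onto the upper indices, and overlay a bracket $(\dots)$ onto each group of $n$ lower indices.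
   Context: Functional realization. Let $a_i^j$, $i,j\in\{1,\dots,n\}$, be the matrix element functions on $GL_n$ ($j$ is the row index, $i$ the column index), and $a_{i_1,\dots,i_k}:=\det(a_i^j)_{i=i_1,\dots,i_k}^{j=1,\dots,k}$. The algebra acts by derivations on lower indices: $E_{i,j}a_j^k=a_i^k$ and $E_{i,j}a_l^k=0$ for $l\ne j$. The irreducible representation with highest weight $[m_1,\dots,m_n]$ (put $m_{n+1}=0$) is realized as the space of functions that can be written as polynomials in the determinants $a_{i_1,\dots,i_k}$ that are homogeneous of degree $m_k-m_{k+1}$ in the determinants of size $k$, for each $k=1,\dots,n$. The tensor product $V\otimes W\otimes U$ is realized in polynomials in three independent sets of matrix elements $a_i^j$ (for $V$), $b_i^j$ (for $W$), $c_i^j$ (for $U$) on $GL_n\times GL_n\times GL_n$. A semi-invariant is a vector that is an eigenvector for all Cartan elements $E_{i,i}$ and is annihilated by all root elements $E_{i,j}$, $i\neq j$. Overlay of a Young symmetrizer. Consider the Young diagram with rows of lengths $m_1,\dots,m_n$, whose $k$-th row is filled with $k$'s. Given a monomial in the $a_i^j$ in which the upper index $k$ occurs $m_k$ times for each $k$, put its factors into the boxes so that factors with upper index $k$ lie in row $k$; the monomial is $\prod_\beta a_{i_\beta}^{\mathrm{row}(\beta)}$, the product being over the boxes $\beta$. The overlay of the Young symmetrizer is the application of the Young symmetrizer to the upper indices: first antisymmetrization of the upper indices over columns, then symmetrization over rows, i.e. the result is $\sum_{r}\sum_{c}\mathrm{sgn}(c)\prod_\beta a_{i_\beta}^{\mathrm{row}(c(r(\beta)))}$,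 where $r$ runs over permutations of boxes preserving each row and $c$ over permutations of boxes preserving each column. The overlays for $b$ and $c$ are defined in the same way using $[M_1,\dots,M_n]$ and $[m'_1,\dots,m'_n]$. An overlay is extended linearly to sums of monomials, lower indices staying attached to their factors. Overlay of a bracket $(\dots)$: one chooses $n$ lower indices of a monomial (the lower indices of $n$ of its factors), gives them the values $1,\dots,n$, and antisymmetrizes these $n$ indices, i.e. takes the sum over all their permutations with the sign of the permutation. Example for $n=2$: $a^1_{(1}b^1_{2)}c^2_1=a_1^1b_2^1c_1^2-a_2^1b_1^1c_1^2$. *)

(* Defs.v *)
From mathcomp Require Import all_boot all_order all_algebra all_fingroup.
From mathcomp Require Import mpoly.

Set Implicit Arguments.
Unset Strict Implicit.
Unset Printing Implicit Defensive.

Import GRing.Theory.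
Local Open Scope ring_scope.

(* The three families of matrix elements a, b, c. *)
Definition sa : 'I_3 := @Ordinal 3 0 isT.
Definition sb : 'I_3 := @Ordinal 3 1 isT.
Definition sc : 'I_3 := @Ordinal 3 2 isT.

(* The variables: (symbol, lower index, upper index).  All indices are shifted
   by one: 'I_n stands for {1, ..., n}. *)
Definition mvar (n : nat) : finType := ('I_3 * 'I_n * 'I_n)%type.

(* Polynomial functions on GL_n x GL_n x GL_n; since GL_n is Zariski dense in
   the n x n matrices they are identified with polynomials. *)
Notation fpoly K n := {mpoly K[#|{: mvar n}|]}.

Section Realization.
Variables (K : fieldType) (n : nat).

Definition mel (s : 'I_3) (i j : 'I_n) : fpoly K n :=
  'X_(enum_rank ((s, i, j) : mvar n)).

(* The derivation with E_{i,j} x_j^k = x_i^k and E_{i,j} x_l^k = 0 for l <> j,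
   for each of x = a, b, c: this is the action on a tensor product. *)
Definition Eop (i j : 'I_n) (p : fpoly K n) : fpoly K n :=
  \sum_(s : 'I_3) \sum_(k : 'I_n)
    mel s i k * p^`M(enum_rank ((s, j, k) : mvar n)).

Definition semi_invariant (p : fpoly K n) : Prop :=
  [/\ p != 0,
      forall i : 'I_n, exists c : K, Eop i i p = c *: p
    & forall i j : 'I_n, i != j -> Eop i j p = 0].

(* The determinant of size k + 1 with lower indices I and upper indices
   1, ..., k + 1. *)
Definition minor (s : 'I_3) (k : 'I_n) (I : {ffun 'I_k.+1 -> 'I_n}) :
    fpoly K n :=
  \det (\matrix_(p < k.+1, q < k.+1) mel s (I p) (widen_ord (ltn_ord k) q)).

Definition minor_idx : finType := {k : 'I_n & {ffun 'I_k.+1 -> 'I_n}}.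

(* The realization, in the functions of the symbol s, of the irreducible
   representation with highest weight m: the values at the determinants of the
   polynomials Q in formal variables (one for each determinant) which are
   homogeneous of degree m_k - m_{k+1} in those standing for determinants of
   size k.  The default value of nth gives m_{n+1} = 0. *)
Definition in_irrep (s : 'I_3) (m : n.-tuple nat) (f : fpoly K n) : Prop :=
  exists Q : {mpoly K[#|{: minor_idx}|]},
    (forall u, u \in msupp Q -> forall k : 'I_n,
       (\sum_(v < #|{: minor_idx}| | tag (enum_val v) == k) u v =
        nth 0 m k - nth 0 m k.+1)%N) /\
    f = Q \mPo [tuple minor s (tagged (enum_val v)) | v < #|{: minor_idx}|].

Definition in_tensor (m M m' : n.-tuple nat) (p : fpoly K n) : Prop :=
  exists (N : nat) (f g h : 'I_N -> fpoly K n),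
    (forall t, [/\ in_irrep sa m (f t), in_irrep sb M (g t)
                 & in_irrep sc m' (h t)]) /\
    p = \sum_(t < N) f t * g t * h t.

End Realization.

Section Overlay.
Variables (K : fieldType) (n : nat).

Definition box (m : n.-tuple nat) : finType := {k : 'I_n & 'I_(nth 0%N m k)}.

Definition brow (m : n.-tuple nat) (x : box m) : 'I_n := tag x.
Definition bcol (m : n.-tuple nat) (x : box m) : nat := tagged x.

Definition row_group (m : n.-tuple nat) : {set {perm box m}} :=
  [set r : {perm box m} | [forall x, brow (r x) == brow x]].
Definition col_group (m : n.-tuple nat) : {set {perm box m}} :=
  [set c : {perm box m} | [forall x, bcol (c x) == bcol x]].

(* The overlay of the Young symmetrizer onto the monomial whose factor in the
   box x is the symbol s with lower index i x and upper index brow x.  A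
   monomial in the symbol s in which each upper index k occurs m_k times is the
   same as such a family i, up to a permutation of each row, which does not
   affect the sum. *)
Definition young (s : 'I_3) (m : n.-tuple nat) (i : box m -> 'I_n) :
    fpoly K n :=
  \sum_(r in row_group m) \sum_(c in col_group m)
    (-1) ^+ c * \prod_(x : box m) mel K s (i x) (brow (c (r x))).

(* The factors of a monomial in a, b, c with the prescribed multiplicities of
   upper indices. *)
Definition factor (m M m' : n.-tuple nat) : finType :=
  (box m + box M + box m')%type.

(* The overlay of the three Young symmetrizers, the lower indices being i. *)
Definition young3 (m M m' : n.-tuple nat) (i : factor m M m' -> 'I_n) :
    fpoly K n :=
  young sa (fun x => i (inl (inl x))) * young sb (fun x => i (inl (inr x))) *
  young sc (fun x => i (inr x)).

(* The factors are divided by g into d groups of n, and the lower indices of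
   each group are given, by l, the values 1, ..., n in some order (so the lower
   indices that the monomial had before play no role); then those of the group
   e are permuted by sigma e. *)
Definition constructed (m M m' : n.-tuple nat) (p : fpoly K n) : Prop :=
  exists (d : nat) (g : factor m M m' -> 'I_d) (l : factor m M m' -> 'I_n),
    [/\ forall e : 'I_d, #|[set f | g f == e]| = n,
        forall e : 'I_d, {in [set f | g f == e] &, injective l}
      & p = \sum_(sigma : {ffun 'I_d -> 'S_n})
              (\prod_(e < d) (-1) ^+ (sigma e)) *
              young3 (fun f => sigma (g f) (l f))].

End Overlay.

(* Main.v *)
(** Products of minors with the prescribed column heights are the column
    antisymmetrizations of the monomials prod_x a_{i(x)}^{row(x)}.  By the
    positivity of Gram matrices (row space of Y = row space of Y^* Y) they are
    spanned by the overlays of Young symmetrizers, so the tensor product is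
    spanned by the young3 k, where k is an assignment of lower indices.

    A semi-invariant p has a single weight d, and integrating the Lie algebra
    action along the segment from 1 to a matrix h gives p(h x) = det(h)^d p(x).
    Cayley's Omega process then recovers p: writing p = sum_k tau_k young3 k,
    both sides are polynomials in h, and applying Omega^d = det(d/dh)^d gives a
    nonzero multiple of p on the right and a combination of bracket overlays on
    the left.  Omega^d is implemented by Ryser's inclusion-exclusion formula for
    permanents, which evaluates both sides at finitely many matrices h. *)

Require Import Defs.
From mathcomp Require Import all_boot all_order all_algebra all_fingroup.
From mathcomp Require Import reals complex mpoly.
From HB Require Import structures.

Set Implicit Arguments.
Unset Strict Implicit.
Unset Printing Implicit Defensive.

Import Order.TTheory GRing.Theory Num.Theory.
Local Open Scope ring_scope.

(** * Linear spans *)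

Section Span.
Variables (K : nzRingType) (V : lmodType K).
Implicit Types (P Q : V -> Prop) (v w : V).

Inductive lspan P : V -> Prop :=
| lspan0 : lspan P 0
| lspan_cons c v w : P v -> lspan P w -> lspan P (c *: v + w).

Lemma lspanW P v : P v -> lspan P v.
Proof. by move=> Pv; rewrite -[v]addr0 -[v]scale1r; apply: lspan_cons (lspan0 P). Qed.

Lemma lspanD P v w : lspan P v -> lspan P w -> lspan P (v + w).
Proof.
elim=> [|c u x Pu _ IH] Pw; first by rewrite add0r.
by rewrite -addrA; apply: lspan_cons (IH Pw).
Qed.

Lemma lspanZ P c v : lspan P v -> lspan P (c *: v).
Proof.
elim=> [|a u x Pu _ IH]; first by rewrite scaler0; apply: lspan0.
by rewrite scalerDr scalerA; apply: lspan_cons.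
Qed.

Lemma lspan_sum P (I : Type) (r : seq I) (B : pred I) (F : I -> V) :
  (forall i, B i -> lspan P (F i)) -> lspan P (\sum_(i <- r | B i) F i).
Proof. by move=> PF; apply: big_ind PF => [|v w]; [apply: lspan0 | apply: lspanD]. Qed.

Lemma lspan_trans P Q v : (forall w, P w -> lspan Q w) -> lspan P v -> lspan Q v.
Proof.
move=> PQ; elim=> [|c u w Pu _ IH]; first exact: lspan0.
by apply: lspanD IH; apply/lspanZ/PQ.
Qed.

Lemma lspanP P v : lspan P v ->
  exists (N : nat) (c : 'I_N -> K) (q : 'I_N -> V),
    (forall t, P (q t)) /\ v = \sum_t c t *: q t.
Proof.
elim=> [|a u w Pu _ [N [c [q [Pq ->]]]]].
  by exists 0%N, (fun=> 0), (fun=> 0); split; [case | rewrite big_ord0].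
exists N.+1, (fun t => oapp c a (unlift ord0 t)), (fun t => oapp q u (unlift ord0 t)).
split=> [t|]; first by case: unliftP => /=.
rewrite big_ord_recl unlift_none /=; congr (_ + _).
by apply: eq_bigr => t _; rewrite liftK.
Qed.

End Span.

(** * Integration of the Lie algebra action *)

Lemma derivation_prod (A B : comNzRingType) (phi D : A -> B) :
    phi 1 = 1 -> {morph phi : a b / a * b} ->
    D 1 = 0 -> (forall a b, D (a * b) = D a * phi b + phi a * D b) ->
  forall (I : finType) (F : I -> A),
  D (\prod_i F i) = \sum_i D (F i) * \prod_(k | k != i) phi (F k).
Proof.
move=> phi1 phiM D1 DM I F.
have phi_prod (r : seq I) : phi (\prod_(k <- r) F k) = \prod_(k <- r) phi (F k).
  exact: (big_morph phi phiM phi1).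
suff H (r : seq I) : uniq r ->
    D (\prod_(i <- r) F i) =
    \sum_(i <- r) D (F i) * \prod_(k <- r | k != i) phi (F k).
  by rewrite H // ?index_enum_uniq //.
elim: r => [|x r IH] /=; first by rewrite !big_nil D1.
case/andP=> xr ur; rewrite !big_cons DM IH // phi_prod.
rewrite eqxx /=; congr (_ + _).
  congr (_ * _); rewrite [RHS]big_seq_cond [LHS]big_seq.
  apply: eq_bigl => k; rewrite andb_idr // => kr.
  by apply: contraNneq xr => <-.
rewrite mulr_sumr [LHS]big_seq [RHS]big_seq; apply: eq_bigr => i ir.
have xi : x != i by apply: contraNneq xr => ->.
by rewrite big_cons xi; exact: mulrCA.
Qed.

Lemma deriv_prod (R : comNzRingType) (I : finType) (F : I -> {poly R}) :
  (\prod_i F i)^`() = \sum_i (F i)^`() * \prod_(k | k != i) F k.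
Proof.
by apply: (@derivation_prod _ _ id) => //; [rewrite derivC | move=> a b; rewrite derivM].
Qed.

(** Differentiating the Leibniz sum differentiates one row at a time; each resulting determinant is
    expanded along that row. *)
Lemma deriv_det (R : comNzRingType) n (G : 'M[{poly R}]_n) :
  (\det G)^`() = \sum_i \sum_j (G i j)^`() * cofactor G i j.
Proof.
rewrite /determinant raddf_sum /=.
transitivity (\sum_i \det (\matrix_(a, b) if a == i then (G a b)^`() else G a b)).
  rewrite exchange_big /=; apply: eq_bigr => s _.
  rewrite -mulr_sumr -signr_odd [_ ^+ odd _]signrE.
  (* Seen as a constant polynomial, the sign has zero derivative. *)
  have -> : 1 - (odd s).*2%:R = ((1 - (odd s).*2%:R)%:P : {poly R}).
    by rewrite rmorphB rmorph1 rmorph_nat.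
  rewrite derivM derivC mul0r add0r deriv_prod; congr (_ * _).
  apply: eq_bigr => i _; rewrite [RHS](bigD1 i) //= mxE eqxx; congr (_ * _).
  by apply: eq_bigr => k /negbTE ki; rewrite mxE ki.
apply: eq_bigr => i _; rewrite (expand_det_row _ i); apply: eq_bigr => j _.
rewrite mxE eqxx; congr (_ * _); rewrite /cofactor; congr (_ * \det _).
by apply/matrixP=> a b; rewrite !mxE eq_sym (negbTE (neq_lift _ _)).
Qed.

Lemma jacobi_formula (R : comNzRingType) n (G : 'M[{poly R}]_n) :
  (\det G)^`() = \tr (map_mx deriv G *m \adj G).
Proof.
rewrite deriv_det; apply: eq_bigr => i _; rewrite mxE.
by apply: eq_bigr => j _; rewrite !mxE.
Qed.

(* In characteristic 0, the coefficients of f satisfy a recursion with no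
   nonzero solution. *)
Lemma poly_ode_eq0 (R : idomainType) (w f : {poly R}) (d : nat) :
    [pchar R] =i pred0 -> w`_0 = 1 -> f`_0 = 0 ->
    w * f^`() = w^`() * f *+ d ->
  f = 0.
Proof.
move=> char0 w0 f0 ode; apply/polyP => k; rewrite coef0.
elim/ltn_ind: k => -[|k] IH //.
have := congr1 (fun q : {poly R} => q`_k) ode; rewrite coefMn !coefM.
rewrite big_ord_recl /= w0 mul1r subn0 coef_deriv.
rewrite big1 => [|i _]; last first.
  rewrite coef_deriv /bump /= add1n IH ?mul0rn ?mulr0 //.
  by rewrite ltnS ltn_subrL (leq_ltn_trans _ (ltn_ord i)).
rewrite big1 => [|i _]; last by rewrite IH ?mulr0 // ltnS leq_subr.
rewrite mul0rn addr0 -mulr_natr => /eqP; rewrite mulf_eq0 => /orP[/eqP //|].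
by rewrite (pcharf0P R).1.
Qed.

(** The difference of the two sides solves the same linear equation and vanishes at 0, so
    [poly_ode_eq0] applies. *)
Lemma poly_ode_pow (R : idomainType) (w u : {poly R}) (d : nat) :
    [pchar R] =i pred0 -> w`_0 = 1 ->
    w * u^`() = w^`() * u *+ d ->
  u = (u`_0)%:P * w ^+ d.
Proof.
move=> char0 w0 ode; apply/eqP; rewrite -subr_eq0; apply/eqP.
apply: (@poly_ode_eq0 _ w _ d) => //.
  rewrite coefB coefCM; suff -> : (w ^+ d)`_0 = 1 by rewrite mulr1 subrr.
  by rewrite -!horner_coef0 in w0 *; rewrite horner_exp w0 expr1n.
rewrite derivB mulrBr ode derivM derivC mul0r add0r deriv_exp mulrBr mulrnBl.
congr (_ - _); case: d {ode} => [|d]; first by rewrite !mulr0n !mulr0.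
rewrite exprS /=; set a := _%:P; set b := w^`(); set x := w ^+ d.
rewrite !mulrnAr; congr (_ *+ _).
by rewrite [LHS]mulrCA [RHS]mulrCA; congr (_ * _); rewrite [LHS]mulrCA.
Qed.

Lemma mpoly_alg_ind (n : nat) (R : comNzRingType) (P : {mpoly R[n]} -> Prop) :
    (forall c, P c%:MP) -> (forall i, P 'X_i) ->
    (forall p q, P p -> P q -> P (p + q)) ->
    (forall p q, P p -> P q -> P (p * q)) ->
  forall p, P p.
Proof.
move=> PC PX PD PM p; rewrite [p]mpolyE.
apply: (big_ind P) => [|//|m _]; first by rewrite -mpolyC0; apply: PC.
rewrite -mul_mpolyC; apply: (PM) => //; rewrite mpolyXE_id.
apply: (big_ind P) => [|//|i _]; first by rewrite -mpolyC1; apply: PC.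
elim: (m i) => [|k IH]; first by rewrite expr0 -mpolyC1; apply: PC.
by rewrite exprS; apply: PM.
Qed.

Lemma mderivXU (n : nat) (R : comNzRingType) (i j : 'I_n) :
  ('X_i : {mpoly R[n]})^`M(j) = (i == j)%:R.
Proof.
rewrite mderivX mnm1E; case: eqVneq => [->|_]; last by rewrite scale0r.
by rewrite -{1}[U_(j)%MM]add0m addmK mpolyX0 scale1r.
Qed.

(** The chain rule along the curve [y], proved on the generators of the polynomial algebra. *)
Lemma deriv_mmap (n : nat) (K S : comNzRingType) (f : {rmorphism K -> {poly S}})
    (y : 'I_n -> {poly S}) (p : {mpoly K[n]}) :
    (forall c, (f c)^`() = 0) ->
  (mmap f y p)^`() = \sum_v mmap f y p^`M(v) * (y v)^`().
Proof.
move=> f'0; elim/mpoly_alg_ind: p => [c|i|p q IHp IHq|p q IHp IHq].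
- rewrite mmapC f'0 big1 // => v _.
  by rewrite mderivC mmap0 mul0r.
- rewrite mmapX mmap1U (bigD1 i) //= big1 ?addr0 => [|v vi].
    by rewrite mderivXU eqxx rmorph1 mul1r.
  by rewrite mderivXU eq_sym (negbTE vi) mmap0 mul0r.
- rewrite mmapD derivD IHp IHq -big_split /=; apply: eq_bigr => v _.
  by rewrite mderivD mmapD mulrDl.
rewrite rmorphM derivM IHp IHq mulr_suml mulr_sumr -big_split /=.
apply: eq_bigr => v _; rewrite mderivM mmapD !rmorphM mulrDl.
by rewrite mulrAC [in X in _ + X]mulrA.
Qed.

Section Action.
Variables (K : fieldType) (n : nat).

Lemma Eop_is_linear i j : linear (@Eop K n i j).
Proof.
move=> c p q; rewrite /Eop scaler_sumr -big_split; apply: eq_bigr => s _.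
rewrite scaler_sumr -big_split; apply: eq_bigr => k _ /=.
by rewrite mderivD mderivZ mulrDr scalerAr.
Qed.
HB.instance Definition _ i j :=
  GRing.isLinear.Build K (fpoly K n) (fpoly K n) _ (Eop i j) (Eop_is_linear i j).

Lemma EopZ i j c (p : fpoly K n) : Eop i j (c *: p) = c *: Eop i j p.
Proof. exact: linearZ. Qed.

Lemma EopM i j (p q : fpoly K n) :
  Eop i j (p * q) = Eop i j p * q + p * Eop i j q.
Proof.
rewrite /Eop mulr_suml mulr_sumr -big_split; apply: eq_bigr => s _.
rewrite mulr_suml mulr_sumr -big_split; apply: eq_bigr => k _ /=.
by rewrite mderivM mulrDr !mulrA [p * mel _ _ _ _]mulrC.
Qed.

Lemma Eop1 i j : Eop i j (1 : fpoly K n) = 0.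
Proof.
rewrite /Eop big1 // => s _; rewrite big1 // => k _.
by rewrite -mpolyC1 mderivC mulr0.
Qed.

Lemma mderiv_mel s (l k : 'I_n) s' j k' :
  (mel K s l k)^`M(enum_rank ((s', j, k') : mvar n)) =
  [&& s == s', l == j & k == k']%:R :> fpoly K n.
Proof. by rewrite mderivXU (inj_eq enum_rank_inj) !xpair_eqE andbA. Qed.

Lemma sum_mderiv_mel (F : 'I_3 -> 'I_n -> fpoly K n) j s l k :
  \sum_s' \sum_k' F s' k' * (mel K s l k)^`M(enum_rank ((s', j, k') : mvar n)) =
  (l == j)%:R * F s k.
Proof.
rewrite (bigD1 s) //= [X in _ + X]big1 ?addr0 => [|s' s's]; last first.
  by rewrite big1 // => k' _; rewrite mderiv_mel eq_sym (negbTE s's) mulr0.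
rewrite (bigD1 k) //= [X in _ + X]big1 ?addr0 => [|k' k'k]; last first.
  by rewrite mderiv_mel [k == _]eq_sym (negbTE k'k) !andbF mulr0.
by rewrite mderiv_mel !eqxx andbT mulrC.
Qed.

Lemma Eop_mel (i j : 'I_n) s l k :
  Eop i j (mel K s l k) = (l == j)%:R * mel K s i k.
Proof. exact: sum_mderiv_mel. Qed.

Lemma Eop_prod i j (I : finType) (F : I -> fpoly K n) :
  Eop i j (\prod_x F x) = \sum_x Eop i j (F x) * \prod_(z | z != x) F z.
Proof.
by apply: (@derivation_prod _ _ id) => //; [exact: Eop1 | exact: EopM].
Qed.

(** Each composition splits into a second-order part [T], symmetric in the two indices, and a
    first-order part [Eop i i] or [Eop j j]. *)
Lemma Eop_commutator i j (p : fpoly K n) :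
  Eop i j (Eop j i p) - Eop j i (Eop i j p) = Eop i i p - Eop j j p.
Proof.
pose T (a b : 'I_n) := \sum_s \sum_k \sum_s' \sum_k'
  mel K s a k * mel K s' b k' *
    p^`M(enum_rank ((s', a, k') : mvar n))^`M(enum_rank ((s, b, k) : mvar n)).
have E a b : Eop a b (Eop b a p) = T a b + Eop a a p.
  rewrite {1}/Eop /T [in X in _ = _ + X]/Eop -big_split; apply: eq_bigr => s _.
  rewrite -big_split; apply: eq_bigr => k _ /=.
  rewrite /Eop raddf_sum mulr_sumr /=.
  (* The single first-order term is spread over all [s'], [k'] with Kronecker deltas, to match the
     product rule term by term. *)
  have -> : mel K s a k * p^`M(enum_rank ((s, a, k) : mvar n)) =
     \sum_s' \sum_k' mel K s a k *
       ((mel K s' b k')^`M(enum_rank ((s, b, k) : mvar n)) *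
        p^`M(enum_rank ((s', a, k') : mvar n))).
    rewrite (bigD1 s) //= [X in _ + X]big1 ?addr0 => [|s' s's]; last first.
      by rewrite big1 // => k' _; rewrite mderiv_mel (negbTE s's) mul0r mulr0.
    rewrite (bigD1 k) //= [X in _ + X]big1 ?addr0 => [|k' k'k]; last first.
      by rewrite mderiv_mel (negbTE k'k) !andbF mul0r mulr0.
    by rewrite mderiv_mel !eqxx mul1r.
  rewrite -big_split; apply: eq_bigr => s' _ /=.
  rewrite raddf_sum mulr_sumr -big_split; apply: eq_bigr => k' _ /=.
  by rewrite mderivM mulrDr addrC !mulrA.
have TC : T i j = T j i.
  rewrite /T.
  under eq_bigr do rewrite exchange_big.
  rewrite exchange_big /=; apply: eq_bigr => s' _.
  under eq_bigr do rewrite exchange_big.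
  rewrite exchange_big /=; apply: eq_bigr => k' _.
  apply: eq_bigr => s _; apply: eq_bigr => k _.
  by rewrite mderiv_comm [mel K s i k * _]mulrC.
by rewrite !E TC opprD addrACA subrr add0r.
Qed.

(** The substitution x -> h x, with [h] acting on the lower indices of all three families at
    once. *)
Definition lin_subst_var (h : 'M[K]_n) (v : 'I_#|{: mvar n}|) : fpoly K n :=
  let: (s, i, k) := (enum_val v : mvar n) in \sum_j h i j *: mel K s j k.

Definition lin_subst (h : 'M[K]_n) (p : fpoly K n) : fpoly K n :=
  mmap (@mpolyC _ K) (lin_subst_var h) p.

HB.instance Definition _ h := GRing.RMorphism.copy (lin_subst h)
  (mmap (@mpolyC _ K) (lin_subst_var h)).

Lemma lin_substZ h c p : lin_subst h (c *: p) = c *: lin_subst h p.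
Proof. by rewrite /lin_subst mmapZ mul_mpolyC. Qed.

Lemma lin_subst_mel h s i k :
  lin_subst h (mel K s i k) = \sum_j h i j *: mel K s j k.
Proof. by rewrite /lin_subst mmapX mmap1U /lin_subst_var enum_rankK. Qed.

Section Curve.
Variables (S : comNzRingType) (f : {rmorphism K -> {poly S}}).
Variables (x : 'I_3 -> 'I_n -> 'I_n -> {poly S}) (G : 'M[{poly S}]_n).
Hypotheses (f'0 : forall c, (f c)^`() = 0) (x'0 : forall s i k, (x s i k)^`() = 0).

Let y (v : 'I_#|{: mvar n}|) : {poly S} :=
  let: (s, i, k) := (enum_val v : mvar n) in \sum_j G i j * x s j k.

Let y_rank s i k : y (enum_rank ((s, i, k) : mvar n)) = \sum_j G i j * x s j k.
Proof. by rewrite /y enum_rankK. Qed.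

(* Along the curve y = G x one has det(G) y' = M y with M = G' adj(G), so the
   derivative of p(y) is a combination of the values of the E_{l,i} p at y. *)
Lemma deriv_mmap_curve p d :
    (forall i j, Eop i j p = (d * (i == j))%:R *: p) ->
  \det G * (mmap f y p)^`() = (\det G)^`() * mmap f y p *+ d.
Proof.
move=> pE; pose M := map_mx deriv G *m \adj G.
(* Cramer's rule recovers [x] from [y] without inverting [G]. *)
have wx s j k :
    \det G * x s j k = \sum_l \adj G j l * y (enum_rank ((s, l, k) : mvar n)).
  under eq_bigr do rewrite y_rank mulr_sumr.
  have adjG j' : \sum_l \adj G j l * (G l j' * x s j' k) =
      (\det G *+ (j == j')) * x s j' k.
    under eq_bigr do rewrite mulrA.
    have /matrixP/(_ j j') := mul_adj_mx G.
    by rewrite !mxE -mulr_suml => ->.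
  rewrite exchange_big /= (bigD1 j) //= [X in _ = _ + X]big1 ?addr0.
    by rewrite adjG eqxx.
  by move=> j' /negbTE j'j; rewrite adjG eq_sym j'j mulr0n mul0r.
have wy s i k : \det G * (y (enum_rank ((s, i, k) : mvar n)))^`() =
    \sum_l M i l * y (enum_rank ((s, l, k) : mvar n)).
  rewrite y_rank raddf_sum mulr_sumr /=.
  under eq_bigr do rewrite derivM x'0 mulr0 addr0 mulrCA wx mulr_sumr.
  rewrite exchange_big; apply: eq_bigr => l _.
  by rewrite !mxE mulr_suml; apply: eq_bigr => j _; rewrite !mxE mulrA.
rewrite (deriv_mmap _ _ f'0) mulr_sumr.
(* For fixed i and l, the terms of the chain rule add up to the value of [Eop l i p] on the
   curve. *)
transitivity (\sum_i \sum_l M i l * mmap f y (Eop l i p)).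
  rewrite (reindex (fun t : mvar n => enum_rank t)) /=; last first.
    by exists enum_val => t _; rewrite ?enum_rankK ?enum_valK.
  transitivity (\sum_s \sum_i \sum_k \sum_l
      mmap f y p^`M(enum_rank ((s, i, k) : mvar n)) *
      (M i l * y (enum_rank ((s, l, k) : mvar n)))).
    rewrite pair_bigA pair_bigA /=; apply: eq_bigr => -[[s i] k] _ /=.
    by rewrite mulrCA wy mulr_sumr.
  rewrite exchange_big; apply: eq_bigr => i _.
  under eq_bigr do rewrite exchange_big.
  rewrite exchange_big; apply: eq_bigr => l _.
  rewrite /Eop raddf_sum mulr_sumr; apply: eq_bigr => s _.
  rewrite raddf_sum mulr_sumr; apply: eq_bigr => k _ /=.
  rewrite rmorphM /= mulrCA; congr (_ * _); rewrite mulrC; congr (_ * _).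
  by rewrite (mmapX _ f) mmap1U.
(* Only the terms l = i survive, and the trace of [M] is the derivative of [\det G]. *)
rewrite jacobi_formula -/M /mxtrace mulr_suml -sumrMnl.
apply: eq_bigr => i _; rewrite (bigD1 i) //= [X in _ + X]big1 => [|l li].
  by rewrite addr0 pE eqxx muln1 (mmapZ _ f) rmorph_nat mulr_natl mulrnAr.
by rewrite pE (negbTE li) muln0 (mmapZ _ f) rmorph0 mul0r mulr0.
Qed.

Lemma horner_mmap (g : {rmorphism K -> S}) (z : 'I_#|{: mvar n}| -> S) a p :
    (forall c, (f c).[a] = g c) -> (forall v, (y v).[a] = z v) ->
  (mmap f y p).[a] = mmap g z p.
Proof.
move=> fg yz; elim/mpoly_alg_ind: p => [c|v|p q IHp IHq|p q IHp IHq].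
- by rewrite (mmapC _ f) fg; symmetry; exact: mmapC.
- by rewrite (mmapX _ f) (mmapX _ g) !mmap1U yz.
- by rewrite (mmapD _ f) (mmapD _ g) hornerD IHp IHq.
by rewrite (rmorphM (mmap f y)) (rmorphM (mmap g z)) hornerM IHp IHq.
Qed.

End Curve.

(** Along the segment [G] from 1 to [h], the function p(G x) solves the equation of [poly_ode_pow]
    with w = [\det G]; the claim is that solution at parameter 1. *)
Lemma lin_subst_weight h p d :
    [pchar K] =i pred0 ->
    (forall i j, Eop i j p = (d * (i == j))%:R *: p) ->
  lin_subst h p = (\det h) ^+ d *: p.
Proof.
move=> char0 pE.
pose f : {rmorphism K -> {poly fpoly K n}} := (polyC \o @mpolyC _ K)%FUN.
pose G : 'M[{poly fpoly K n}]_n := 1%:M + 'X *: map_mx f (h - 1%:M).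
pose x s i k : {poly fpoly K n} := (mel K s i k)%:P.
have f'0 c : (f c)^`() = 0 by rewrite derivC.
have x'0 s i k : (x s i k)^`() = 0 by rewrite derivC.
have fE a c : (f c).[a] = c%:MP by rewrite hornerC.
have GE (a : K) : map_mx (horner_eval a%:MP) G = map_mx (@mpolyC _ K) (1%:M + a *: (h - 1%:M)).
  apply/matrixP=> i j; rewrite !mxE /horner_eval !hornerE /=.
  by case: (i == j); rewrite !hornerE ?(mpolyCD, mpolyC1) ?mpolyCM ?mpolyCD.
have yE (a : K) v :
    (let: (s, i, k) := (enum_val v : mvar n) in \sum_j G i j * x s j k).[a%:MP] =
    lin_subst_var (1%:M + a *: (h - 1%:M)) v.
  rewrite /lin_subst_var; case: (enum_val v) => -[s i] k; rewrite horner_sum.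
  apply: eq_bigr => j _; have /matrixP/(_ i j) := GE a.
  by rewrite mxE [RHS]mxE /horner_eval => Ga; rewrite hornerM hornerC Ga mul_mpolyC.
have evE a := horner_mmap p (fE a%:MP) (yE a).
have detE a : (\det G).[a%:MP] = (\det (1%:M + a *: (h - 1%:M)))%:MP.
  by rewrite -/(horner_eval _ _) -det_map_mx GE det_map_mx.
have w0 : (\det G)`_0 = 1.
  by rewrite -horner_coef0 -mpolyC0 detE scale0r addr0 det1.
have S0 : [pchar fpoly K n] =i pred0 by move=> q; rewrite pchar_lalg char0.
have := poly_ode_pow S0 w0 (deriv_mmap_curve G f'0 x'0 pE).
move/(congr1 (fun q => q.[1%:MP])); rewrite evE scale1r addrC subrK => uE.
rewrite /lin_subst uE hornerM hornerC horner_exp detE scale1r addrC subrK.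
rewrite -horner_coef0 -mpolyC0 evE scale0r addr0 mulrC -mul_mpolyC rmorphXn.
(* It remains to see that substituting the identity matrix gives back [p]. *)
congr (_ * _); rewrite -[RHS]comp_mpoly_id /comp_mpoly.
apply: eq_bigr => m _; congr (_ * _); apply: mmap1_eq => v.
rewrite tnth_mktuple /lin_subst_var -{2}[v]enum_valK.
case: (enum_val v) => -[s i] k; rewrite (bigD1 i) //= big1 ?addr0.
  by rewrite mxE eqxx scale1r.
by move=> j /negbTE ji; rewrite mxE eq_sym ji scale0r.
Qed.

(** [Eop i i] is an Euler operator: it counts the degree in the variables of lower index i. *)
Lemma Eop_diag_mpolyX (i : 'I_n) (m : 'X_{1.. #|{: mvar n}|}) :
  Eop i i ('X_[m] : fpoly K n) =
  (\sum_s \sum_k m (enum_rank ((s, i, k) : mvar n)))%:R *: 'X_[m].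
Proof.
rewrite /Eop natr_sum scaler_suml; apply: eq_bigr => s _.
rewrite natr_sum scaler_suml; apply: eq_bigr => k _.
rewrite mderivX -scalerAr; set v := enum_rank _.
have [->|mv] := posnP (m v); first by rewrite !scale0r.
congr (_ *: _); rewrite /mel -mpolyXD; congr 'X_[_].
by rewrite addmC submK // lep1mP -lt0n.
Qed.

Lemma Eop_diag_coef (i : 'I_n) (p : fpoly K n) m :
  (Eop i i p)@_m =
  (\sum_s \sum_k m (enum_rank ((s, i, k) : mvar n)))%:R * p@_m.
Proof.
rewrite {1}[p]mpolyE (linear_sum (Eop i i)) raddf_sum /=.
under eq_bigr do rewrite linearZ /= Eop_diag_mpolyX !mcoeffZ mcoeffX.
have [mp|mp] := boolP (m \in msupp p).
  rewrite (bigD1_seq m) //= eqxx mulr1 [X in _ + X]big1 ?addr0 1?mulrC // => m' /negbTE m'm.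
  by rewrite m'm !mulr0.
rewrite (memN_msupp_eq0 mp) mulr0 [LHS]big1_seq // => m' /andP[_ m'p].
case: eqVneq => [m'm|_]; last by rewrite !mulr0.
by rewrite -m'm m'p in mp.
Qed.

(** A monomial of p is an eigenvector of [Eop i0 i0] whose eigenvalue is a degree, so the weight at
    [i0] is a natural number. The commutator of [Eop i i0] and [Eop i0 i] kills p, hence all the
    weights agree. *)
Lemma semi_invariant_weight (p : fpoly K n) :
    [pchar K] =i pred0 -> (0 < n)%N -> semi_invariant p ->
  exists d : nat, forall i j, Eop i j p = (d * (i == j))%:R *: p.
Proof.
move=> char0 n_gt0 [p0 diag offdiag].
pose i0 := Ordinal n_gt0.
have [m mp] : exists m, m \in msupp p.
  case E: (msupp p) => [|m r]; last by exists m; rewrite mem_head.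
  by rewrite -msupp_eq0 E in p0.
exists (\sum_s \sum_k m (enum_rank ((s, i0, k) : mvar n)))%N => i j.
have [<-|ij] := eqVneq i j; last by rewrite offdiag // muln0 scale0r.
rewrite muln1.
have E0 : Eop i0 i0 p = (\sum_s \sum_k m (enum_rank ((s, i0, k) : mvar n)))%:R *: p.
  have [c cE] := diag i0; rewrite cE; congr (_ *: _).
  have := Eop_diag_coef i0 p m; rewrite cE mcoeffZ => /mulIf; apply.
  by rewrite -mcoeff_msupp.
have [-> //|i0i] := eqVneq i i0.
have EE a b : a != b -> Eop b a (Eop a b p) = 0.
  by move=> ab; rewrite (offdiag a b ab) (linear0 (Eop b a)).
have := Eop_commutator i i0 p; rewrite !EE // 1?eq_sym // subrr => /esym/eqP.
by rewrite subr_eq0 => /eqP ->.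
Qed.

End Action.

(** * The Omega process *)

(** Expand the product of the 1 + b x, where b is 0 on T and -1 elsewhere: any element outside T
    contributes a zero factor. *)
Lemma sum_sign_supset (R : comNzRingType) (G : finType) (T : {set G}) :
  \sum_(S : {set G} | T \subset S) (-1) ^+ #|~: S| = (T == setT)%:R :> R.
Proof.
pose b x : R := if x \in T then 0 else -1.
transitivity (\prod_x (1 + b x)).
  rewrite bigA_distr [RHS](bigID (fun S : {set G} => T \subset S)) /=.
  rewrite [X in _ = _ + X]big1 ?addr0 => [|S /subsetPn[x xT xS]]; last first.
    by rewrite (bigD1 x) //= (negbTE xS) /b xT mul0r.
  apply: eq_bigr => S TS.
  rewrite (bigID (mem S)) /= big1 ?mul1r => [|x -> //].
  rewrite -prodr_const [RHS](eq_big (fun x => x \in ~: S) (fun=> -1)) //.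
    by move=> x; rewrite inE.
  move=> x xS; rewrite (negbTE xS) /b; case: ifP => // xT.
  by rewrite (subsetP TS) in xS.
case: eqVneq => [T1|neT].
  by rewrite big1 // => x _; rewrite /b T1 inE addr0.
have [x xT] : exists x, x \notin T.
  by apply/existsP; apply: contra_neqT neT => /existsPn T1; apply/setP=> x; rewrite inE; apply/negPn.
by rewrite (bigD1 x) //= /b (negbTE xT) subrr mul0r.
Qed.

(** Expand the products over all maps [pi]. The signs of the sets S containing the image of [pi]
    cancel unless [pi] is onto, which for equal cardinals means injective. *)
Lemma ryser_formula (R : comNzRingType) (F G : finType) (a : F -> G -> R) :
    #|F| = #|G| ->
  \sum_(S : {set G}) (-1) ^+ #|~: S| * \prod_f \sum_(g in S) a f g =
  \sum_(pi : {ffun F -> G} | injectiveb pi) \prod_f a f (pi f).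
Proof.
move=> FG.
under eq_bigr do rewrite bigA_distr_big mulr_sumr.
rewrite (exchange_big_dep xpredT) //= [RHS]big_mkcond; apply: eq_bigr => pi _.
rewrite -mulr_suml.
have -> : \sum_(S : {set G} | pi \in ffun_on (mem S)) (-1) ^+ #|~: S| = (injectiveb pi)%:R :> R.
  rewrite (eq_bigl (fun S : {set G} => pi @: setT \subset S)).
    rewrite sum_sign_supset; congr (nat_of_bool _)%:R.
    rewrite eqEcard subsetT /= cardsT -FG -cardsT; apply/idP/idP => H.
      have /imset_injP piI : #|pi @: setT| == #|[set: F]|.
        by rewrite eqn_leq leq_imset_card.
      by apply/injectiveP=> x y; apply: piI; rewrite inE.
    by rewrite card_imset //; apply/injectiveP.
  move=> S; apply/ffun_onP/subsetP => [H _ /imsetP[x _ ->]|H x].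
    exact: H.
  by apply: H; apply: imset_f.
by case: ifP; rewrite ?mul1r ?mul0r.
Qed.

Lemma sum_injective_ffun (V : nmodType) (T : finType) (f : {ffun T -> T} -> V) :
  \sum_(pi : {ffun T -> T} | injectiveb pi) f pi = \sum_(s : {perm T}) f (pval s).
Proof.
rewrite (reindex (fun s : {perm T} => pval s)) /=.
  by apply: eq_bigl => s; apply: (valP s).
exists (insubd (1%g : {perm T})) => [s _|s si]; first by rewrite valKd.
exact: insubdK.
Qed.

Section Omega.
Variables (K : numFieldType) (n d : nat).
Local Notation slot := ('I_d * 'I_n)%type.
Local Notation family := {ffun 'I_d -> 'S_n}.
Implicit Types (s t : family) (V : lmodType K).

Definition family_sign s : K := \prod_(e < d) (-1) ^+ (s e).
(** The entry of h picked by the slot (e, i) in the Leibniz term [s e] of the e-th factor of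
    det(h)^d. *)
Definition slot_label s (x : slot) : 'I_n * 'I_n := (x.2, s x.1 x.2).

(** The number Omega^d(det^d): a monomial of derivatives applied to a monomial of the same degree
    counts the bijections that match their labels. *)
Definition omega_const : K :=
  \sum_s \sum_t family_sign s * family_sign t *
    \sum_(pi : {ffun slot -> slot} | injectiveb pi)
      \prod_x (slot_label s (pi x) == slot_label t x)%:R.

Lemma prod_eq_natr (T : finType) (U : eqType) (f g : T -> U) :
  \prod_x (f x == g x)%:R = [forall x, f x == g x]%:R :> K.
Proof.
case: (altP forallP) => [fg|nfg]; first by rewrite big1 // => x _; rewrite fg.
have /existsP[x /negbTE fgx] : [exists x, f x != g x].
  by rewrite -negb_forall.
by rewrite (bigD1 x) //= fgx mul0r.
Qed.

(* Up to a positive factor, omega_const is the sum of the squares of the D w;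
   the diagonal word has D w > 0, as only the trivial family produces it. *)
Lemma omega_const_gt0 : 0 < omega_const.
Proof.
pose word s (p : {perm slot}) := [ffun x => slot_label s (p x)].
pose D (w : {ffun slot -> 'I_n * 'I_n}) : K :=
  \sum_s \sum_(p : {perm slot}) family_sign s * (word s p == w)%:R.
(* Permuting the slots of a word only permutes the terms of [D]. *)
have D_perm s (p q : {perm slot}) : D [ffun x => word s p (q x)] = D (word s p).
  apply: eq_bigr => t _; rewrite (reindex_inj (mulgI q)) /=.
  apply: eq_bigr => r _; congr (_ * _%:R); congr (nat_of_bool _).
  apply/eqP/eqP => [/ffunP E|/ffunP E]; apply/ffunP => x; last first.
    by have := E (q x); rewrite !ffunE permM.
  by have := E (q^-1%g x); rewrite !ffunE permM permKV.
have omegaE : omega_const = \sum_s family_sign s * D (word s 1%g).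
  apply: eq_bigr => s _; rewrite mulr_sumr; apply: eq_bigr => t _.
  rewrite -mulrA mulr_sumr; congr (_ * _).
  rewrite sum_injective_ffun (reindex_inj invg_inj) /=.
  apply: eq_bigr => p _; congr (_ * _); rewrite prod_eq_natr.
  congr (_%:R); congr (nat_of_bool _); apply/forallP/eqP => [E|/ffunP E].
    apply/ffunP => x; rewrite !ffunE perm1; have := E (p x).
    by rewrite pvalE permK => /eqP.
  move=> x; have := E ((p^-1)%g x); rewrite !ffunE perm1 permKV => ->.
  by rewrite pvalE.
(* The sum of squares is a sum over p of terms which, by [D_perm], do not depend on p; each of them
   is [omega_const]. *)
have sumD : \sum_w D w ^+ 2 = omega_const *+ #|{perm slot}|.
  rewrite omegaE -sumr_const -[RHS]/(\sum_(p in {perm slot}) _).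
  transitivity (\sum_(p : {perm slot}) \sum_s family_sign s * D (word s p)).
    under eq_bigr => w _ do rewrite expr2 {1}/D mulr_suml.
    rewrite exchange_big /= [RHS]exchange_big /=; apply: eq_bigr => s _.
    under eq_bigr do rewrite mulr_suml.
    rewrite exchange_big /=; apply: eq_bigr => p _.
    rewrite (bigD1 (word s p)) //= eqxx mulr1 big1 ?addr0 // => w.
    by rewrite eq_sym => /negbTE ->; rewrite mulr0 mul0r.
  apply: eq_bigr => p _; apply: eq_bigr => s _; congr (_ * _).
  rewrite -(D_perm s 1%g p); congr (D _); apply/ffunP => x.
  by rewrite !ffunE perm1.
have D_real w : D w \is Num.real.
  apply: rpred_sum => s _; apply: rpred_sum => p _; apply: rpredM; last exact: realn.
  by apply: rpred_prod => e _; rewrite rpredX // rpredN rpred1.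
have D2_ge0 w : 0 <= D w ^+ 2 by rewrite real_exprn_even_ge0.
pose w0 : {ffun slot -> 'I_n * 'I_n} := [ffun x => (x.2, x.2)].
have Dw0 : 0 < D w0.
  rewrite /D (bigD1 [ffun=> 1%g]) //= [X in _ + X]big1 ?addr0; last first.
    move=> s s1; rewrite big1 // => p _; case: eqP => [/ffunP E|_]; last by rewrite mulr0.
    case/eqP: s1; apply/ffunP => e; rewrite ffunE; apply/permP => i.
    have := E ((p^-1)%g (e, i)); rewrite !ffunE permKV /slot_label /= perm1.
    by case=> <- ->.
  have -> : family_sign [ffun=> 1%g] = 1.
    by rewrite /family_sign big1 // => e _; rewrite ffunE odd_perm1.
  rewrite (bigD1 1%g) //= mul1r.
  have /eqP -> : word [ffun=> 1%g] 1%g == w0.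
    by apply/eqP/ffunP => x; rewrite !ffunE /slot_label perm1 ffunE perm1.
  (* The identity permutation contributes 1, the others contribute non-negative terms. *)
  by rewrite eqxx ltr_pwDl // sumr_ge0 // => p _; rewrite mul1r ler0n.
have : 0 < omega_const *+ #|{perm slot}|.
  rewrite -sumD (bigD1 w0) //= ltr_pwDl ?exprn_gt0 //.
  by apply: sumr_ge0 => w _.
by rewrite pmulrn_lgt0 //; apply/card_gt0P; exists 1%g.
Qed.

(* The matrices at which Ryser's formula polarizes: sums of the elementary
   matrices labelled by S.  A slot (e, i) is the row i of the e-th factor of
   det(h)^d. *)
Definition slot_mx s (S : {set slot}) : 'M[K]_n :=
  \matrix_(i, j) \sum_(x in S) ((i, j) == slot_label s x)%:R.

Lemma det_expr (h : 'M[K]_n) :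
  \det h ^+ d = \sum_t family_sign t * \prod_(x : slot) h x.2 (t x.1 x.2).
Proof.
rewrite -[d in LHS]card_ord -prodr_const bigA_distr_bigA /=.
apply: eq_bigr => t _; rewrite big_split /=; congr (_ * _).
by rewrite pair_bigA.
Qed.

(** This is the value on det(h)^d of the single monomial of derivatives that [s] contributes to
    Omega^d. *)
Lemma ryser_det s :
  \sum_(S : {set slot}) (-1) ^+ #|~: S| * \det (slot_mx s S) ^+ d =
  \sum_t family_sign t *
    \sum_(pi : {ffun slot -> slot} | injectiveb pi)
      \prod_x (slot_label s (pi x) == slot_label t x)%:R.
Proof.
under eq_bigr do rewrite det_expr mulr_sumr.
rewrite exchange_big /=; apply: eq_bigr => t _.
under eq_bigr do rewrite mulrCA.
rewrite -mulr_sumr; congr (_ * _).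
under [RHS]eq_bigr do under eq_bigr do rewrite eq_sym.
rewrite -(ryser_formula (fun x g => (slot_label t x == slot_label s g)%:R)) //.
apply: eq_bigr => S _; congr (_ * _); apply: eq_bigr => x _.
by rewrite mxE.
Qed.

(** The hypothesis is evaluated at the matrices [slot_mx s S], and the results are combined with the
    signs of Ryser's formula and of the families s. This replaces differentiation in h. *)
Lemma omega_process V (F : finType) (y : {ffun F -> 'I_n} -> V)
    (tau : {ffun F -> 'I_n} -> K) :
    #|F| = (d * n)%N ->
    (forall h : 'M[K]_n,
       \sum_k tau k *: \sum_(k' : {ffun F -> 'I_n}) (\prod_f h (k f) (k' f)) *: y k' =
       \det h ^+ d *: \sum_k tau k *: y k) ->
  omega_const *: (\sum_k tau k *: y k) =
  \sum_(k : {ffun F -> 'I_n})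
   \sum_(pi : {ffun F -> slot} | injectiveb pi && [forall f, (pi f).2 == k f])
    tau k *: \sum_s family_sign s *: y [ffun f => s (pi f).1 (pi f).2].
Proof.
move=> cardF hE.
have swapZ (a b : K) (v : V) : a *: (b *: v) = b *: (a *: v).
  by rewrite !scalerA mulrC.
have cardFs : #|F| = #|{: slot}| by rewrite cardF card_prod !card_ord.
(* The right side of the hypothesis produces [omega_const], by [ryser_det]. *)
transitivity (\sum_s family_sign s *: \sum_(S : {set slot}) (-1) ^+ #|~: S| *:
    \sum_k tau k *: \sum_(k' : {ffun F -> 'I_n}) (\prod_f slot_mx s S (k f) (k' f)) *: y k').
  rewrite /omega_const scaler_suml; apply: eq_bigr => s _.
  under [in RHS]eq_bigr do rewrite hE scalerA.
  rewrite -scaler_suml ryser_det scalerA mulr_sumr.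
  by congr (_ *: _); apply: eq_bigr => t _; rewrite mulrA.
(* On the left side, Ryser's formula turns the products of entries into sums over bijections from
   factors to slots. *)
transitivity (\sum_s family_sign s *: \sum_k tau k *: \sum_(k' : {ffun F -> 'I_n})
   (\sum_(pi : {ffun F -> slot} | injectiveb pi)
      \prod_f ((k f, k' f) == slot_label s (pi f))%:R) *: y k').
  apply: eq_bigr => s _; congr (_ *: _).
  under eq_bigr do rewrite scaler_sumr.
  rewrite exchange_big; apply: eq_bigr => k _ /=.
  under eq_bigr do rewrite swapZ scaler_sumr.
  rewrite -scaler_sumr exchange_big; congr (_ *: _); apply: eq_bigr => k' _ /=.
  under eq_bigr do rewrite scalerA.
  rewrite -scaler_suml; congr (_ *: _).
  rewrite -(ryser_formula (fun f g => ((k f, k' f) == slot_label s g)%:R)) //.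
  apply: eq_bigr => S _; congr (_ * _); apply: eq_bigr => f _.
  by rewrite mxE.
under eq_bigr do rewrite scaler_sumr.
rewrite exchange_big; apply: eq_bigr => k _ /=.
under eq_bigr do rewrite swapZ.
rewrite -scaler_sumr -scaler_sumr; congr (_ *: _).
rewrite [RHS]exchange_big; apply: eq_bigr => s _ /=.
rewrite -scaler_sumr; congr (_ *: _).
under eq_bigr do rewrite scaler_suml.
rewrite exchange_big [RHS]big_mkcondr; apply: eq_bigr => pi _ /=.
under eq_bigr do rewrite prod_eq_natr.
have [/forallP pk|npk] := boolP [forall f, (pi f).2 == k f]; last first.
  rewrite big1 // => k' _; case: forallP => [E|_]; last by rewrite scale0r.
  by case/forallP: npk => f; have /eqP[-> _] := E f.
(* The labels determine [k'] from [pi] and [s], so a single term is left. *)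
rewrite (bigD1 [ffun f => s (pi f).1 (pi f).2]) //= [X in _ + X]big1 ?addr0.
  rewrite (introT forallP) ?scale1r // => f; rewrite ffunE /slot_label.
  by rewrite (eqP (pk f)).
move=> k' k'E; case: forallP => [E|_]; last by rewrite scale0r.
case/eqP: k'E; apply/ffunP => f; rewrite ffunE.
by have /eqP[_ ->] := E f.
Qed.

End Omega.

(** * Overlays of brackets *)

Section TensorForm.
Variables (K : numFieldType) (n : nat) (F Theta : finType).
Variables (s : F -> 'I_3) (a : Theta -> K) (rho : Theta -> F -> 'I_n).

(** The common shape of the overlays on upper indices: the upper indices [rho t] vary with the term,
    while the lower indices [k] stay attached to the factors. *)
Definition tensor_form (k : F -> 'I_n) : fpoly K n :=
  \sum_t a t *: \prod_f mel K (s f) (k f) (rho t f).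

Lemma eq_tensor_form k k' : k =1 k' -> tensor_form k = tensor_form k'.
Proof.
move=> kk'; apply: eq_bigr => t _; congr (_ *: _).
by apply: eq_bigr => f _; rewrite kk'.
Qed.

Lemma lin_subst_tensor_form (h : 'M[K]_n) k :
  lin_subst h (tensor_form k) =
  \sum_(k' : {ffun F -> 'I_n}) (\prod_f h (k f) (k' f)) *: tensor_form k'.
Proof.
rewrite /tensor_form rmorph_sum /=.
under [RHS]eq_bigr do rewrite scaler_sumr.
rewrite [RHS]exchange_big /=; apply: eq_bigr => t _.
rewrite lin_substZ rmorph_prod /=.
under eq_bigr do rewrite lin_subst_mel.
rewrite bigA_distr_bigA scaler_sumr /=; apply: eq_bigr => k' _.
by rewrite scaler_prod !scalerA mulrC.
Qed.

(** By the Leibniz rule, the occurrences of the index j are turned into i one at a time. *)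
Lemma Eop_tensor_form i j k :
  Eop i j (tensor_form k) =
  \sum_f (k f == j)%:R *: tensor_form (fun g => if g == f then i else k g).
Proof.
rewrite /tensor_form (linear_sum (Eop i j)).
under [RHS]eq_bigr do rewrite scaler_sumr.
rewrite [RHS]exchange_big /=; apply: eq_bigr => t _.
rewrite EopZ Eop_prod scaler_sumr; apply: eq_bigr => f _.
rewrite Eop_mel scalerA [_%:R * a t]mulrC -scalerA; congr (_ *: _).
rewrite scaler_nat -mulrA mulr_natl; congr (_ *+ _).
rewrite [RHS](bigD1 f) //= eqxx; congr (_ * _).
by apply: eq_bigr => g /negbTE ->.
Qed.

Section Bracket.
Variables (d : nat) (g : F -> 'I_d) (l : F -> 'I_n).
Hypothesis card_g : forall e : 'I_d, #|[set f | g f == e]| = n.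
Hypothesis l_inj : forall e : 'I_d, {in [set f | g f == e] &, injective l}.

Definition bracket_form : fpoly K n :=
  \sum_(sigma : {ffun 'I_d -> 'S_n})
    family_sign K sigma *: tensor_form (fun f => sigma (g f) (l f)).

(** An injection of the n elements of a group into n values is onto. *)
Lemma group_index e i : exists2 f, g f = e & l f = i.
Proof.
have : i \in l @: [set f | g f == e].
  suff -> : l @: [set f | g f == e] = setT by rewrite inE.
  by apply/eqP; rewrite eqEcard subsetT /= cardsT card_ord card_in_imset ?card_g.
by case/imsetP => f; rewrite inE => /eqP gf ->; exists f.
Qed.

(** In each group exactly one factor carries the index j. If i = j, each of the d groups reproduces
    the form; otherwise the group gets the index i twice, and antisymmetry kills its
    contribution. *)
Lemma Eop_bracket_form i j :
  Eop i j bracket_form = (d * (i == j))%:R *: bracket_form.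
Proof.
pose k (sigma : {ffun 'I_d -> 'S_n}) f := sigma (g f) (l f).
pose kij sigma e f := if (g f == e) && (k sigma f == j) then i else k sigma f.
transitivity (\sum_e \sum_(sigma : {ffun 'I_d -> 'S_n})
    family_sign K sigma *: tensor_form (kij sigma e)).
  rewrite /bracket_form (linear_sum (Eop i j)) [RHS]exchange_big /=.
  apply: eq_bigr => sigma _; rewrite EopZ -scaler_sumr.
  congr (_ *: _); rewrite Eop_tensor_form (partition_big g xpredT) //=.
  apply: eq_bigr => e _.
  have [f gf lf] := group_index e ((sigma e)^-1%g j).
  have kf : sigma (g f) (l f) = j by rewrite gf lf permKV.
  have uniq f' : g f' = e -> sigma (g f') (l f') = j -> f' = f.
    move=> gf'; rewrite gf' => /(canRL (permK _)); rewrite -lf => lf'.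
    by apply: (l_inj (e := e)); rewrite ?inE ?gf ?gf'.
  rewrite (bigD1 f) ?gf //= [X in _ + X]big1 ?addr0.
    rewrite -gf kf eqxx scale1r; apply: eq_tensor_form => f' /=.
    have [->|f'f] := eqVneq f' f; first by rewrite /kij /k kf !eqxx.
    rewrite /kij /k; case: eqP => //= gf'; case: eqP => // kf'.
    by case/eqP: f'f; apply: uniq => //; rewrite gf'.
  move=> f' /andP[/eqP gf' f'f]; case: eqP => [kf'|]; last by rewrite scale0r.
  by case/eqP: f'f; apply: uniq.
case: eqVneq => [ij|ij].
  transitivity (\sum_(e < d) bracket_form); last first.
    by rewrite sumr_const card_ord muln1 scaler_nat.
  apply: eq_bigr => e _; apply: eq_bigr => sigma _; congr (_ *: _).
  by apply: eq_tensor_form => f; rewrite /kij; case: andP => // -[_ /eqP kf]; rewrite ij -kf.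
rewrite muln0 scale0r big1 // => e _.
(* Exchanging the values i and j in the group e reverses the sign but not the indices [kij], where
   both values have become i. *)
pose flip (sigma : {ffun 'I_d -> 'S_n}) : {ffun 'I_d -> 'S_n} :=
  [ffun e' => if e' == e then (sigma e * tperm i j)%g else sigma e'].
have flipK : involutive flip.
  move=> sigma; apply/ffunP => e'; rewrite !ffunE eqxx.
  by case: eqP => [->|//]; rewrite -mulgA tperm2 mulg1.
set T := \sum_sigma _.
have TN : T = - T.
  rewrite {1}/T (reindex_inj (inv_inj flipK)) -sumrN; apply: eq_bigr => sigma _.
  rewrite -scaleNr; congr (_ *: _).
    rewrite /family_sign !(bigD1 e (P := xpredT)) //= -mulNr !ffunE eqxx.
    rewrite odd_permM odd_tperm ij addbT signrN; congr (_ * _).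
    by apply: eq_bigr => e' /negbTE e'e; rewrite ffunE e'e.
  apply: eq_tensor_form => f; rewrite /kij /k ffunE.
  case: eqP => //= ->; rewrite permM.
  by case: tpermP => [->|->|/eqP/negbTE _ /eqP/negbTE ->]; rewrite ?eqxx ?(negbTE ij).
have : 2%:R *: T == 0 by rewrite scaler_nat mulr2n {1}TN addNr.
by rewrite scaler_eq0 pnatr_eq0 => /eqP.
Qed.

End Bracket.
End TensorForm.

Lemma weight_semi_invariant (K : fieldType) n (p : fpoly K n) d :
    (forall i j, Eop i j p = (d * (i == j))%:R *: p) ->
  p = 0 \/ semi_invariant p.
Proof.
move=> pE; have [->|p0] := eqVneq p 0; [by left | right].
split=> // [i|i j /negbTE ij]; first by exists (d * (i == i))%:R.
by rewrite pE ij muln0 scale0r.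
Qed.

Lemma sign_scale (K : fieldType) N d n (sigma : {ffun 'I_d -> 'S_n}) (p : {mpoly K[N]}) :
  (\prod_(e < d) (-1) ^+ (sigma e)) * p = (\prod_(e < d) (-1) ^+ (sigma e)) *: p.
Proof.
rewrite -mul_mpolyC rmorph_prod; congr (_ * _); apply: eq_bigr => e _ /=.
by rewrite rmorph_sign.
Qed.

(** * Young overlays and the bracket expansion of semi-invariants *)

Section Young.
Variables (K : numFieldType) (n : nat).

(** Extended by zero outside the row and column groups, so that the overlay becomes a [tensor_form]
    summed over a whole finite type. *)
Definition young_sign (m : n.-tuple nat) (t : {perm box m} * {perm box m}) : K :=
  if (t.1 \in row_group m) && (t.2 \in col_group m) then (-1) ^+ t.2 else 0.

Lemma young_tensor_form s m (i : box m -> 'I_n) :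
  young K s i =
  tensor_form (fun=> s) (@young_sign m) (fun t x => brow (t.2 (t.1 x))) i.
Proof.
rewrite /young /tensor_form -(pair_bigA _ (fun r c => young_sign (r, c) *:
  \prod_x mel K s (i x) (brow (c (r x))))) /= big_mkcond.
apply: eq_bigr => r _; rewrite /young_sign /=; case: ifP => _ /=; last first.
  by rewrite big1 // => c _; rewrite scale0r.
rewrite big_mkcond; apply: eq_bigr => c _; case: ifP => _; last by rewrite scale0r.
by rewrite -mul_mpolyC rmorph_sign.
Qed.

Lemma eq_young s (m : n.-tuple nat) (i i' : box m -> 'I_n) :
  i =1 i' -> young K s i = young K s i'.
Proof. by move=> ii'; rewrite !young_tensor_form; apply: eq_tensor_form. Qed.

Variables m M m' : n.-tuple nat.
Local Notation F := (factor m M m').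
Local Notation index := (({perm box m} * {perm box m}) *
  ({perm box M} * {perm box M}) * ({perm box m'} * {perm box m'}))%type.

Definition factor_symbol (f : F) : 'I_3 :=
  match f with inl (inl _) => sa | inl (inr _) => sb | inr _ => sc end.

Definition young3_sign (t : index) : K :=
  young_sign t.1.1 * young_sign t.1.2 * young_sign t.2.

Definition young3_row (t : index) (f : F) : 'I_n :=
  match f with
  | inl (inl x) => brow (t.1.1.2 (t.1.1.1 x))
  | inl (inr x) => brow (t.1.2.2 (t.1.2.1 x))
  | inr x => brow (t.2.2 (t.2.1 x))
  end.

Lemma young3_tensor_form (i : F -> 'I_n) :
  young3 K i = tensor_form factor_symbol young3_sign young3_row i.
Proof.
rewrite /young3 !young_tensor_form /tensor_form big_distrlr /= pair_bigA.
rewrite big_distrlr /= pair_bigA /=; apply: eq_bigr => -[[t u] v] _ /=.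
rewrite !big_sumType /= -!scalerAl -!scalerAr -!scalerAl !scalerA.
by rewrite mulrAC.
Qed.

Lemma constructed_semi_invariant (p : fpoly K n) :
  constructed m M m' p -> p = 0 \/ semi_invariant p.
Proof.
case=> d [g [l [card_g l_inj pE]]].
have -> : p = bracket_form factor_symbol young3_sign young3_row g l.
  by rewrite pE; apply: eq_bigr => sigma _; rewrite sign_scale young3_tensor_form.
by apply: weight_semi_invariant => i j; apply: Eop_bracket_form.
Qed.

(** The equivariance p(h x) = det(h)^d p(x) feeds [omega_process]; each bijection [pi] from factors
    to slots is a division into groups together with a labelling, so it gives one bracket
    overlay. *)
Lemma semi_invariant_bracket (tau : {ffun F -> 'I_n} -> K) (p : fpoly K n) :
    (0 < n)%N -> p = \sum_k tau k *: young3 K k -> semi_invariant p ->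
  lspan (@constructed K n m M m') p.
Proof.
move=> n_gt0 pE p_si.
have char0 : [pchar K] =i pred0 by exact: pchar_num.
have [d dE] := semi_invariant_weight char0 n_gt0 p_si.
pose y (k : {ffun F -> 'I_n}) : fpoly K n := young3 K k.
have hE (h : 'M[K]_n) : \sum_k tau k *: \sum_(k' : {ffun F -> 'I_n})
    (\prod_f h (k f) (k' f)) *: y k' = \det h ^+ d *: \sum_k tau k *: y k.
  rewrite -[in RHS]pE -(lin_subst_weight h char0 dE) pE rmorph_sum /=.
  apply: eq_bigr => k _; rewrite lin_substZ young3_tensor_form.
  rewrite lin_subst_tensor_form; congr (_ *: _); apply: eq_bigr => k' _.
  by rewrite /y young3_tensor_form.
(* Evaluating at the scalar matrix 2 compares degrees: the powers 2^#|F| and 2^(n d) coincide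
   because p is nonzero. *)
have cardF : #|{: F}| = (d * n)%N.
  have [p0 _ _] := p_si.
  have := hE 2%:R%:M; rewrite -pE det_scalar -exprM => h2.
  have : 2%:R ^+ #|{: F}| *: p = 2%:R ^+ (n * d) *: p.
    rewrite -h2 {1}pE scaler_sumr; apply: eq_bigr => k _.
    rewrite (bigD1 k) //= [X in _ + X]big1 ?addr0.
      under eq_bigr do rewrite mxE eqxx mulr1n.
      by rewrite prodr_const !scalerA mulrC.
    move=> k' k'k; have /existsP[f kf] : [exists f, k f != k' f].
      rewrite -negb_forall; apply: contraNN k'k => /forallP kk'.
      by apply/eqP/ffunP => f; rewrite (eqP (kk' f)).
    by rewrite (bigD1 f) //= mxE (negbTE kf) mul0r scale0r.
  move/eqP; rewrite -subr_eq0 -scalerBl scaler_eq0 (negbTE p0) orbF subr_eq0.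
  by rewrite -!natrX eqr_nat eqn_exp2l // mulnC => /eqP.
have N0 : omega_const K n d != 0 by rewrite gt_eqF ?omega_const_gt0.
have := omega_process cardF hE; rewrite -pE.
move/(congr1 (fun q => (omega_const K n d)^-1 *: q)).
rewrite scalerA mulVf // scale1r => ->.
apply/lspanZ/lspan_sum => k _; apply: lspan_sum => pi /andP[/injectiveP pi_inj _].
apply/lspanZ/lspanW.
have pi_surj e : [set f | (pi f).1 == e] = pi @^-1: [set x | x.1 == e].
  by apply/setP => f; rewrite !inE.
(* A slot is a pair (group, label), and bijectivity of [pi] puts n factors in each group. *)
exists d, (fun f => (pi f).1), (fun f => (pi f).2); split.
- move=> e; rewrite pi_surj on_card_preimset.
    rewrite (_ : [set x | x.1 == e] = setX [set e] setT) ?cardsX ?cards1 ?cardsT ?card_ord ?mul1n //.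
    by apply/setP => x; rewrite !inE andbT.
  apply: onW_bij; apply: inj_card_bij => //.
  by rewrite card_prod !card_ord cardF.
- move=> e f f'; rewrite !inE => /eqP fe /eqP f'e ff'; apply: pi_inj.
  by rewrite [LHS]surjective_pairing [RHS]surjective_pairing fe f'e ff'.
apply: eq_bigr => s _; rewrite sign_scale; congr (_ *: _).
by rewrite /y !young3_tensor_form; apply: eq_tensor_form => f; rewrite ffunE.
Qed.
End Young.

(** * Products of minors as column antisymmetrizations *)

Section PermTransfer.
Variables (N : nat) (T : finType) (f : 'I_N -> T) (g : T -> 'I_N).
Hypotheses (fK : cancel f g) (gK : cancel g f).

Let conj_inj (s : 'S_N) : injective (fun x => f (s (g x))).
Proof. by move=> x y /(can_inj fK)/perm_inj/(can_inj gK). Qed.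

Definition perm_transfer (s : 'S_N) : {perm T} := perm (@conj_inj s).

Lemma perm_transferE s x : perm_transfer s x = f (s (g x)).
Proof. by rewrite permE. Qed.

Lemma perm_transferM s t :
  perm_transfer (s * t) = (perm_transfer s * perm_transfer t)%g.
Proof. by apply/permP => x; rewrite permM !perm_transferE permM fK. Qed.

Lemma perm_transfer_tperm i j : perm_transfer (tperm i j) = tperm (f i) (f j).
Proof.
apply/permP => x; rewrite permE -{2}[x]gK.
by rewrite inj_tperm //; apply: can_inj fK.
Qed.

(** Transfer is multiplicative and sends transpositions to transpositions, which generate. *)
Lemma odd_perm_transfer s : perm_transfer s = s :> bool.
Proof.
have [ts -> _] := prod_tpermP s.
elim: ts => [|[i j] ts IH]; rewrite ?big_nil ?big_cons.
  rewrite odd_perm1 (_ : perm_transfer 1 = 1%g) ?odd_perm1 //.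
  by apply/permP => x; rewrite permE !perm1 gK.
rewrite perm_transferM perm_transfer_tperm !odd_permM IH !odd_tperm.
by rewrite (inj_eq (can_inj fK)).
Qed.

Lemma perm_transfer_bij : bijective perm_transfer.
Proof.
have inv_inj (t : {perm T}) : injective (fun i => g (t (f i))).
  by move=> x y /(can_inj gK)/perm_inj/(can_inj fK).
exists (fun t => perm (@inv_inj t)) => s; apply/permP => x.
  by rewrite permE permE !fK.
by rewrite permE permE !gK.
Qed.

Lemma det_leibniz_transfer (R : comNzRingType) (a : T -> T -> R) :
  \det (\matrix_(i, j) a (f i) (f j)) =
  \sum_(c : {perm T}) (-1) ^+ c * \prod_x a x (c x).
Proof.
rewrite [RHS](reindex perm_transfer) /=; last first.
  exact/onW_bij/perm_transfer_bij.
apply: eq_bigr => s _; rewrite odd_perm_transfer; congr (_ * _).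
rewrite [RHS](reindex f) /=; last by apply/onW_bij; exists g.
by apply: eq_bigr => i _; rewrite mxE perm_transferE fK.
Qed.

End PermTransfer.

(** Take determinants in the identity [E] between products of block triangular matrices. *)
Lemma sylvester_det (R : comNzRingType) p q (U : 'M[R]_(p, q)) (V : 'M[R]_(q, p)) :
  \det (1%:M + U *m V) = \det (1%:M + V *m U).
Proof.
have E : block_mx 1%:M 0 (- V) 1%:M *m block_mx 1%:M U 0 (1%:M + V *m U) =
         block_mx (1%:M + U *m V) U 0 1%:M *m block_mx 1%:M 0 (- V) 1%:M.
  rewrite !mulmx_block !mul1mx !mulmx1 !mul0mx !mulmx0 !addr0 !add0r.
  by rewrite mulNmx mulmxN addrK addrCA addNr addr0.
have := congr1 determinant E; rewrite !det_mulmx !det_ublock !det_lblock !det1.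
by rewrite !mul1r !mulr1.
Qed.

(** The [P j] play the role of inclusions of the blocks of a block diagonal matrix. The sum is the
    product of the matrices 1 + P_j (D_j - 1) P_j^T, and Sylvester's identity reduces the
    determinant of each to that of [D j]. *)
Lemma det_block_sum (R : comNzRingType) (J : finType) (N : nat) (h : J -> nat)
    (P : forall j, 'M[R]_(N, h j)) (D : forall j, 'M[R]_(h j)) :
    (forall j, (P j)^T *m P j = 1%:M) ->
    (forall j j', j != j' -> (P j)^T *m P j' = 0) ->
    \sum_j P j *m (P j)^T = 1%:M ->
  \det (\sum_j P j *m D j *m (P j)^T) = \prod_j \det (D j).
Proof.
move=> Pjj Pjj' sumP.
suff H (r : seq J) : uniq r ->
    \det (1%:M + \sum_(j <- r) P j *m (D j - 1%:M) *m (P j)^T) =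
    \prod_(j <- r) \det (D j).
  rewrite -H ?index_enum_uniq // -sumP -big_split /=; congr (\det _).
  by apply: eq_bigr => j _; rewrite mulmxBr mulmxBl mulmx1 addrC subrK.
elim: r => [|j r IH] /=; first by rewrite !big_nil addr0 det1.
case/andP=> jr ur; rewrite !big_cons -IH //.
set S := \sum_(_ <- r) _; set E := _ *m _ *m _.
(* Distinct blocks are orthogonal, so the product below has no cross terms. *)
have PS : E *m S = 0.
  rewrite /E /S mulmx_sumr big_seq big1 // => j' j'r.
  transitivity (P j *m (D j - 1%:M) *m ((P j)^T *m P j') *m
                ((D j' - 1%:M) *m (P j')^T)); first by rewrite !mulmxA.
  rewrite Pjj' ?mulmx0 ?mul0mx //.
  by apply: contraNneq jr => ->.
have -> : 1%:M + (E + S) = (1%:M + E) *m (1%:M + S).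
  by rewrite mulmxDl !mulmxDr !mulmx1 !mul1mx PS addr0 addrAC addrA addrAC.
rewrite det_mulmx; congr (_ * _).
rewrite /E -mulmxA sylvester_det -mulmxA Pjj mulmx1.
by rewrite addrC subrK.
Qed.

(** The matrix [a] is block diagonal once X is listed by [xi]; its determinant is handled by
    [det_block_sum], with the 0/1 matrices of the block inclusions as [P j]. *)
Lemma block_leibniz (R : comNzRingType) (X J : finType) (h : J -> nat)
    (xi : {j : J & 'I_(h j)} -> X) (a : X -> X -> R) :
    bijective xi ->
    (forall u v, tag u != tag v -> a (xi u) (xi v) = 0) ->
  \sum_(c : {perm X}) (-1) ^+ c * \prod_x a x (c x) =
  \prod_j \det (\matrix_(p < h j, q < h j)
    a (xi (Tagged (fun j => 'I_(h j)) p)) (xi (Tagged (fun j => 'I_(h j)) q))).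
Proof.
move=> [ix xiK ixK] a0.
rewrite -(det_leibniz_transfer (@enum_valK X) (@enum_rankK X)).
pose x j (q : 'I_(h j)) : X := xi (Tagged (fun j => 'I_(h j)) q).
pose P j : 'M[R]_(#|X|, h j) := \matrix_(b, q) (enum_val b == x j q)%:R.
have PP j j' q q' : ((P j)^T *m P j') q q' = (x j q == x j' q')%:R.
  rewrite !mxE (bigD1 (enum_rank (x j q))) //= !mxE enum_rankK eqxx mul1r.
  rewrite big1 ?addr0 // => b /negbTE bx; rewrite !mxE.
  by rewrite -(inj_eq enum_rank_inj) enum_valK bx mul0r.
have PE b j q : P j b q = (enum_val b == x j q)%:R by rewrite mxE.
have xE j q j' q' : (x j q == x j' q') =
    (Tagged (fun j => 'I_(h j)) q == Tagged (fun j => 'I_(h j)) q').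
  exact: (can_eq xiK).
have xP (b : 'I_#|X|) : exists j, exists q, enum_val b = x j q.
  by exists (tag (ix (enum_val b))), (tagged (ix (enum_val b))); rewrite /x taggedK ixK.
have sum_P j (b : 'I_#|X|) (F : 'I_(h j) -> R) q0 : enum_val b = x j q0 ->
    \sum_q F q * P j b q = F q0.
  move=> bE; rewrite (bigD1 q0) //= PE bE eqxx mulr1 big1 ?addr0 // => q qq0.
  by rewrite PE bE xE eq_Tagged /= eq_sym (negbTE qq0) mulr0.
have P0 j (b : 'I_#|X|) q j' q' : enum_val b = x j' q' -> j != j' -> P j b q = 0.
  move=> bE jj'; rewrite PE bE xE -tag_eqE /tag_eq /= eq_sym.
  by rewrite (negbTE jj').
rewrite -(@det_block_sum _ J #|X| h P).
- congr (\det _); apply/matrixP => b b'; rewrite mxE summxE.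
  have [j1 [q1 b'E]] := xP b'; have [j0 [q0 bE]] := xP b.
  rewrite (bigD1 j1) //= [X in _ + X]big1 ?addr0 => [|j jj1]; last first.
    by rewrite mxE big1 // => q _; rewrite [_^T _ _]mxE (P0 _ _ _ _ _ b'E jj1) mulr0.
  rewrite mxE; under eq_bigr do rewrite [_^T _ _]mxE.
  rewrite (sum_P _ _ _ _ b'E) mxE bE b'E.
  have [j01|j01] := eqVneq j0 j1; last first.
    rewrite [LHS]a0 // big1 // => q _.
    by rewrite (P0 _ _ _ _ _ bE) ?mul0r // eq_sym.
  case: _ / j01 in q1 b'E *.
  under eq_bigr do rewrite mulrC.
  by rewrite (sum_P _ _ _ _ bE) mxE.
- move=> j; apply/matrixP => q q'; rewrite PP mxE xE eq_Tagged.
  by [].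
- move=> j j' jj'; apply/matrixP => q q'; rewrite PP mxE xE -tag_eqE /tag_eq /=.
  by rewrite (negbTE jj').
apply/matrixP => b b'; rewrite summxE mxE.
have [j1 [q1 b'E]] := xP b'.
rewrite (bigD1 j1) //= [X in _ + X]big1 ?addr0 => [|j jj1]; last first.
  by rewrite mxE big1 // => q _; rewrite [_^T _ _]mxE (P0 _ _ _ _ _ b'E jj1) mulr0.
rewrite mxE; under eq_bigr do rewrite [_^T _ _]mxE.
by rewrite (sum_P _ _ _ _ b'E) PE -b'E (inj_eq enum_val_inj).
Qed.

Lemma tagged_ord_inj (J : finType) (h : J -> nat) (u v : {j : J & 'I_(h j)}) :
  tag u = tag v -> tagged u = tagged v :> nat -> u = v.
Proof.
case: u v => j p [j' q] /= jj'; case: _ / jj' in q *.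
by move=> pq; congr existT; apply: val_inj.
Qed.

Section Columns.
Variables (K : numFieldType) (n : nat) (m : n.-tuple nat) (s : 'I_3).
Hypotheses (n_gt0 : (0 < n)%N) (m_sorted : sorted geq m).
Local Notation part := (nth 0%N m).

Lemma part_antitone k k' : (k <= k')%N -> (part k' <= part k)%N.
Proof.
move=> kk'; have [k'm|mk'] := ltnP k' (size m); last by rewrite (nth_default _ mk').
apply: (@sorted_leq_nth _ geq) => //; rewrite ?inE //.
- by move=> a b c /= ba cb; apply: leq_trans cb ba.
- exact: leqnn.
exact: leq_ltn_trans kk' k'm.
Qed.

Lemma part_nth_n : part n = 0%N.
Proof. by rewrite nth_default ?size_tuple. Qed.

Definition col_antisym (i : box m -> 'I_n) : fpoly K n :=
  \sum_(c in col_group m) (-1) ^+ c * \prod_x mel K s (i x) (brow (c x)).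

Lemma eq_col_antisym i i' : i =1 i' -> col_antisym i = col_antisym i'.
Proof.
move=> ii'; apply: eq_bigr => c _; congr (_ * _).
by apply: eq_bigr => x _; rewrite ii'.
Qed.

(** Rows are counted from 0, so column j has tag (w j) + 1 boxes: the heights form the conjugate
    partition of m. *)
Definition column_heights (w : 'I_(part 0) -> minor_idx n) : Prop :=
  forall j (k : 'I_n), (k <= tag (w j))%N = (j < part k)%N.

(** Setting to zero the entries between different columns extends the sum to all permutations of the
    boxes. The result is a block diagonal determinant with one block, a minor, for each column. *)
Lemma col_antisym_minors (w : 'I_(part 0) -> minor_idx n) (t : 'I_n -> nat -> 'I_n) :
    column_heights w ->
    (forall j (p : 'I_(tag (w j)).+1),
       tagged (w j) p = t (widen_ord (ltn_ord (tag (w j))) p) j) ->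
  col_antisym (fun x => t (brow x) (bcol x)) = \prod_j minor K s (tagged (w j)).
Proof.
move=> wh wt; pose h j := (tag (w j)).+1.
have xi_proof (u : {j : 'I_(part 0) & 'I_(h j)}) :
    (tag u < part (widen_ord (ltn_ord (tag (w (tag u)))) (tagged u)))%N.
  by rewrite -wh /= -ltnS.
(* The boxes listed column by column. *)
pose xi (u : {j : 'I_(part 0) & 'I_(h j)}) : box m :=
  Tagged (fun k : 'I_n => 'I_(part k)) (Ordinal (xi_proof u)).
have col_proof (x : box m) : (bcol x < part 0)%N.
  exact: leq_trans (ltn_ord (tagged x)) (part_antitone (leq0n _)).
have row_proof (x : box m) : (brow x < h (Ordinal (col_proof x)))%N.
  by rewrite /h ltnS wh /=; apply: ltn_ord.
have xi_bij : bijective xi.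
  exists (fun x => Tagged (fun j => 'I_(h j)) (Ordinal (row_proof x))) => x.
    by apply: tagged_ord_inj => //; apply: val_inj.
  by apply: tagged_ord_inj => //; apply: val_inj.
pose a (x y : box m) : fpoly K n :=
  if bcol x == bcol y then mel K s (t (brow x) (bcol x)) (brow y) else 0.
transitivity (\sum_(c : {perm box m}) (-1) ^+ c * \prod_x a x (c x)).
  rewrite /col_antisym big_mkcond; apply: eq_bigr => c _.
  case: ifPn; rewrite inE; [move/forallP=> cc | case/forallPn=> x cx].
    by congr (_ * _); apply: eq_bigr => x _; rewrite /a eq_sym cc.
  by rewrite (bigD1 x) //= /a eq_sym (negbTE cx) mul0r mulr0.
rewrite (block_leibniz xi_bij) => [|u v uv].
  apply: eq_bigr => j _; congr (\det _); apply/matrixP => p q.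
  by rewrite !mxE /a /= /bcol /= eqxx wt.
by rewrite /a /bcol /= ifN.
Qed.

Lemma column_height_exists j : (j < part 0)%N ->
  exists k0 : 'I_n, forall k : 'I_n, (k <= k0)%N = (j < part k)%N.
Proof.
move=> jm; pose i0 := Ordinal n_gt0.
case: (@arg_maxnP _ i0 (fun k : 'I_n => j < part k)%N (fun k : 'I_n => k : nat)) => //.
move=> k0 jk0 k0max; exists k0 => k; apply/idP/idP => [kk0|]; last exact: k0max.
exact: leq_trans jk0 (part_antitone kk0).
Qed.

Lemma col_antisym_factor (i : box m -> 'I_n) :
  exists2 w, column_heights w & col_antisym i = \prod_j minor K s (tagged (w j)).
Proof.
have hP (j : 'I_(part 0)) : {k0 : 'I_n | [forall k : 'I_n, (k <= k0)%N == (j < part k)%N]}.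
  apply: sigW; have [k0 k0P] := column_height_exists (ltn_ord j).
  by exists k0; apply/forallP => k; rewrite k0P.
(* The filling i extended to all pairs (row, column), with an arbitrary value outside the
   diagram. *)
pose t (k : 'I_n) (j : nat) : 'I_n :=
  oapp (fun o : 'I_(part k) => i (Tagged (fun k : 'I_n => 'I_(part k)) o)) k (insub j).
pose w j : minor_idx n := Tagged (fun k : 'I_n => {ffun 'I_k.+1 -> 'I_n})
  [ffun p : 'I_(sval (hP j)).+1 => t (widen_ord (ltn_ord (sval (hP j))) p) j].
have wh : column_heights w.
  by move=> j k; have /forallP/(_ k)/eqP := svalP (hP j).
exists w => //; rewrite -(@col_antisym_minors w t wh) => [|j p]; last by rewrite ffunE.
apply: eq_col_antisym => -[k o]; rewrite /t /brow /bcol /=.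
by rewrite insubT //= => lt; congr (i (Tagged _ _)); apply: val_inj.
Qed.

Lemma card_ord_lt N a : (a <= N)%N -> (\sum_(j < N) (j < a) = a)%N.
Proof.
move=> aN; rewrite -big_mkcond /= (big_ord_narrow aN) sum_nat_const card_ord.
by rewrite muln1.
Qed.

(** The columns of height k + 1 are those that meet row k but not row k + 1. *)
Lemma card_column_height w (k : 'I_n) : column_heights w ->
  (\sum_j (tag (w j) == k) = part k - part k.+1)%N.
Proof.
move=> wh.
have lt_tag j : (k < tag (w j))%N = (j < part k.+1)%N.
  (* For the last row, k + 1 = n is out of range and [nth] returns 0, while no column is higher than
     n. *)
  have [kn|nk] := ltnP k.+1 n; first by rewrite -(wh j (Ordinal kn)).
  rewrite (@nth_default _ _ _ k.+1) ?size_tuple // ltn0.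
  by apply/negbTE; rewrite -leqNgt -ltnS (leq_trans (ltn_ord _)).
rewrite -{1}(card_ord_lt (part_antitone (leq0n k))).
rewrite -{1}(card_ord_lt (part_antitone (leq0n k.+1))).
rewrite -sumnB => [|j _]; last first.
  by rewrite -lt_tag -(wh j k); case: ltngtP.
apply: eq_bigr => j _; rewrite -lt_tag -(wh j k) -val_eqE.
by case: ltngtP.
Qed.

Lemma in_irrep0 : in_irrep s m (0 : fpoly K n).
Proof. by exists 0; split=> [u|]; rewrite ?msupp0 // comp_mpoly0. Qed.

Lemma in_irrepD f g : in_irrep s m f -> in_irrep s m g ->
  in_irrep s m (f + g : fpoly K n).
Proof.
move=> [Q [Qh ->]] [Q' [Qh' ->]]; exists (Q + Q'); split; last by rewrite comp_mpolyD.
by move=> u /msuppD_le; rewrite mem_cat => /orP[/Qh|/Qh'].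
Qed.

Lemma in_irrepZ c f : in_irrep s m f -> in_irrep s m (c *: f : fpoly K n).
Proof.
move=> [Q [Qh ->]]; exists (c *: Q); split; last by rewrite comp_mpolyZ.
by move=> u /msuppZ_le /Qh.
Qed.

Lemma in_irrep_span P (f : fpoly K n) :
  (forall g, P g -> in_irrep s m g) -> lspan P f -> in_irrep s m f.
Proof.
move=> Pm; elim=> [|c g h Pg _ IH]; first exact: in_irrep0.
by apply: in_irrepD => //; apply/in_irrepZ/Pm.
Qed.

Definition is_col_antisym (f : fpoly K n) : Prop :=
  exists i : {ffun box m -> 'I_n}, f = col_antisym i.

Lemma col_antisym_irrep i : in_irrep s m (col_antisym i).
Proof.
have [w wh ->] := col_antisym_factor i.
(* The exponent of a minor is the number of columns in which it occurs. *)
pose u : 'X_{1.. #|{: minor_idx n}|} := (\sum_j U_(enum_rank (w j)))%MM.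
exists 'X_[u]; split.
  move=> u'; rewrite msuppX inE => /eqP -> k.
  rewrite -(card_column_height k wh).
  have uE v : u v = (\sum_j (enum_rank (w j) == v))%N.
    by rewrite /u mnm_sumE; apply: eq_bigr => j _; rewrite mnm1E.
  under [LHS]eq_bigr do rewrite uE.
  rewrite exchange_big; apply: eq_bigr => j _ /=.
  rewrite big_mkcond (bigD1 (enum_rank (w j))) //= big1 ?addn0.
    by rewrite enum_rankK eqxx; case: eqP.
  by move=> v /negbTE vw; case: ifP => // _; rewrite eq_sym vw.
rewrite /u -mprodXE rmorph_prod /=; apply: eq_bigr => j _.
by rewrite comp_mpolyXU -tnth_nth tnth_mktuple enum_rankK.
Qed.

(** The predicate passes to earlier entries of the sorted list, so it holds exactly on an initial
    segment, whose length is the count. *)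
Lemma nth_sorted_count (T : Type) (x0 : T) (r : rel T) (p : pred T) (t : seq T) j :
    transitive r -> (forall a b, r a b -> p b -> p a) -> sorted r t ->
    (j < size t)%N ->
  p (nth x0 t j) = (j < count p t)%N.
Proof.
move=> r_tr rp; rewrite sorted_pairwise //.
elim: t j => //= x t IH j /andP[rx rt].
case px: (p x); last first.
  have np i : (i < size t)%N -> p (nth x0 t i) = false.
    move=> it; apply/negP => pi.
    by have := rp _ _ (elimT (all_nthP x0) rx i it) pi; rewrite px.
  have -> : count p t = 0%N.
    apply/eqP; rewrite -leqn0 leqNgt -has_count; apply/negP.
    by case/(has_nthP x0) => i it; rewrite np.
  by case: j => //= j; rewrite ltnS => /np.
by case: j => //= j; rewrite ltnS => jt; rewrite IH.
Qed.

(** A telescoping sum, by induction on n - k; the truncated subtractions are exact because the parts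
    decrease. *)
Lemma sum_part_tail (k : nat) : (k <= n)%N ->
  (\sum_(k' < n | (k <= k')%N) (part k' - part k'.+1) = part k)%N.
Proof.
move=> kn; rewrite -(subKn kn); elim: (n - k)%N (leq_subr k n) => [|c IH] cn.
  rewrite subn0 part_nth_n big1 // => k' nk'.
  by move: (ltn_ord k'); rewrite ltnNge nk'.
have lt : (n - c.+1 < n)%N by rewrite ltn_subrL.
have e : (n - c.+1).+1 = (n - c)%N by rewrite subnSK.
rewrite (bigD1 (Ordinal lt)) //= e (eq_bigl (fun k' : 'I_n => (n - c <= k')%N)).
  by rewrite IH 1?ltnW // subnK // part_antitone // -e.
by move=> k'; rewrite -e [RHS]ltn_neqAle andbC [in RHS]eq_sym -val_eqE.
Qed.

(** List the minors of the monomial with multiplicity, by decreasing size, and let the j-th be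
    column j. The homogeneity condition says that the sizes are the column heights. *)
Lemma irrep_monomial_cols (u : 'X_{1.. #|{: minor_idx n}|}) :
    (forall k : 'I_n, \sum_(v < #|{: minor_idx n}| | tag (enum_val v) == k) u v =
       part k - part k.+1)%N ->
  is_col_antisym (\prod_v minor K s (tagged (enum_val v)) ^+ u v).
Proof.
move=> uE; pose i0 := Ordinal n_gt0.
pose v0 : minor_idx n := Tagged (fun k : 'I_n => {ffun 'I_k.+1 -> 'I_n}) [ffun p : 'I_i0.+1 => i0].
pose r (v v' : minor_idx n) := (tag v' <= tag v)%N.
have r_tot : total r by move=> v v'; apply: leq_total.
have r_tr : transitive r by move=> v v' v'' vv' v''v; apply: leq_trans v''v vv'.
pose t0 := flatten [seq nseq (u (enum_rank v)) v | v <- index_enum (minor_idx n)].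
pose t := sort r t0.
have count_t (k : nat) : (k <= n)%N -> count (fun v : minor_idx n => k <= tag v)%N t = part k.
  move=> kn; rewrite count_sort -(sum_part_tail kn) /t0 count_flatten sumnE !big_map.
  under [RHS]eq_bigr do rewrite -uE.
  rewrite [RHS](exchange_big_dep (fun v : 'I_#|{: minor_idx n}| => k <= tag (enum_val v))%N) /=; last first.
    by move=> k' v kk' /eqP ->.
  rewrite (reindex (@enum_val (minor_idx n) xpredT)) /=; last first.
    exact/onW_bij/enum_val_bij.
  rewrite [RHS]big_mkcond; apply: eq_bigr => v _.
  rewrite count_nseq enum_valK; case: ifP => kv; rewrite ?mul1n ?mul0n //.
  rewrite (big_pred1 (tag (enum_val v))) // => k' /=.
  by rewrite eq_sym; case: eqP => [->|_]; rewrite ?kv ?andbF.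
have size_t : size t = part 0.
  by rewrite -(count_t 0%N) // -{1}(count_predT t); apply: eq_count.
pose w (j : 'I_(part 0)) := nth v0 t j.
have wh : column_heights w.
  move=> j k; rewrite -(count_t k (ltnW (ltn_ord k))).
  apply: (@nth_sorted_count _ v0 r (fun v : minor_idx n => k <= tag v)%N) => //.
  - by move=> v v' v'v kv'; apply: leq_trans kv' v'v.
  - exact: sort_sorted.
  by rewrite size_t.
(* At the boxes [inord k] is exact, since row k lies within the height of column j. *)
pose T (k : 'I_n) (j : nat) : 'I_n := tagged (nth v0 t j) (inord k).
exists [ffun x => T (brow x) (bcol x)].
rewrite (eq_col_antisym (i' := fun x => T (brow x) (bcol x))) => [|x]; last by rewrite ffunE.
rewrite (col_antisym_minors wh) => [|j p]; last first.
  by rewrite /T -/(w j) /= inord_val.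
transitivity (\prod_(v <- t) minor K s (tagged v)); last first.
  by rewrite (big_nth v0) size_t big_mkord.
rewrite (perm_big t0) /=; last by rewrite perm_sort.
rewrite big_flatten big_map /=.
rewrite (reindex (@enum_val (minor_idx n) xpredT)) /=; last first.
  exact/onW_bij/enum_val_bij.
apply: eq_bigr => v _; rewrite enum_valK.
by rewrite big_nseq -[RHS]/(iter _ _ _) iter_mulr_1.
Qed.

Lemma in_irrep_cols (f : fpoly K n) : in_irrep s m f -> lspan is_col_antisym f.
Proof.
case=> Q [Qh ->]; rewrite [Q]mpolyE rmorph_sum /= big_seq.
apply: lspan_sum => u /Qh uE; rewrite comp_mpolyZ comp_mpolyX.
apply/lspanZ/lspanW.
under eq_bigr do rewrite tnth_mktuple.
exact: irrep_monomial_cols.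
Qed.

End Columns.

(** * Young symmetrizers *)

(** If Z is killed by Y^T Y, then W = Y Z has zero Gram matrix, so the squared norms of its entries
    sum to zero in each column. Conjugation enters because Z need not be real. *)
Lemma real_mx_sub_gram (K : numClosedFieldType) a b (Y : 'M[K]_(a, b)) :
  (forall i j, Y i j \is Num.real) -> (Y <= Y^T *m Y)%MS.
Proof.
move=> Yreal; rewrite submxE; set Z := cokermx _.
have W0 : Y^T *m (Y *m Z) = 0 by rewrite mulmxA mulmx_coker.
set W := Y *m Z in W0 *; apply/eqP/matrixP => i j; rewrite [RHS]mxE.
have sqW : (map_mx Num.conj W)^T *m W = 0.
  rewrite {1}/W map_mxM trmx_mul (_ : map_mx Num.conj Y = Y).
    by rewrite -mulmxA W0 mulmx0.
  by apply/matrixP => x y; rewrite mxE conj_Creal.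
have /matrixP/(_ j j) := sqW; rewrite !mxE.
under eq_bigr do rewrite !mxE mulrC -normCK.
move=> /eqP; rewrite psumr_eq0 => [|x _]; last by rewrite exprn_ge0.
move/allP/(_ i (mem_index_enum _)).
by rewrite /= sqrf_eq0 normr_eq0 => /eqP.
Qed.

Section Symmetrizer.
Variables (K : numClosedFieldType) (X T : finType) (V : lmodType K).
Local Notation word := {ffun X -> T}.
Implicit Types (i j k : word) (G : {group {perm X}}).

Definition word_act i (p : {perm X}) : word := [ffun x => i (p x)].

Lemma word_actM i p q : word_act (word_act i p) q = word_act i (q * p)%g.
Proof. by apply/ffunP => x; rewrite !ffunE permM. Qed.

Lemma word_act1 i : word_act i 1%g = i.
Proof. by apply/ffunP => x; rewrite ffunE perm1. Qed.

Variable P : word -> V.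

(** Scalar matrices indexed by words act on V-valued functions of words, so that identities between
    matrices can be applied to [P]. *)
Definition mx_apply (N : 'M[K]_#|{: word}|) (v : word -> V) i : V :=
  \sum_j N (enum_rank i) (enum_rank j) *: v j.

Lemma mx_applyM N N' v i : mx_apply (N *m N') v i = mx_apply N (mx_apply N' v) i.
Proof.
rewrite /mx_apply; under [RHS]eq_bigr do rewrite scaler_sumr.
rewrite exchange_big; apply: eq_bigr => j _ /=.
rewrite mxE (reindex (@enum_rank word)) /=; last exact/onW_bij/enum_rank_bij.
by rewrite scaler_suml; apply: eq_bigr => k _; rewrite scalerA.
Qed.

Lemma mx_apply_scale N c v i : mx_apply (c *: N) v i = c *: mx_apply N v i.
Proof. by rewrite scaler_sumr; apply: eq_bigr => j _; rewrite mxE scalerA. Qed.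

Lemma mx_applyZ N c v i : mx_apply N (fun j => c *: v j) i = c *: mx_apply N v i.
Proof.
by rewrite scaler_sumr; apply: eq_bigr => j _; rewrite !scalerA mulrC.
Qed.

Lemma eq_mx_apply N v v' i : v =1 v' -> mx_apply N v i = mx_apply N v' i.
Proof. by move=> vv'; apply: eq_bigr => j _; rewrite vv'. Qed.

Definition average_mx G (chi : {perm X} -> K) : 'M[K]_#|{: word}| :=
  \matrix_(a, b) \sum_(p in G) chi p * (word_act (enum_val a) p == enum_val b)%:R.

Lemma average_mxE G chi v i :
  mx_apply (average_mx G chi) v i = \sum_(p in G) chi p *: v (word_act i p).
Proof.
rewrite /mx_apply; under eq_bigr do rewrite mxE !enum_rankK scaler_suml.
rewrite exchange_big; apply: eq_bigr => p _ /=.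
rewrite (bigD1 (word_act i p)) //= eqxx mulr1 big1 ?addr0 // => j.
by rewrite eq_sym => /negbTE ->; rewrite mulr0 scale0r.
Qed.

Lemma tr_average_mx G chi : (forall p, chi p^-1%g = chi p) ->
  (average_mx G chi)^T = average_mx G chi.
Proof.
move=> chiV; apply/matrixP => a b; rewrite !mxE.
rewrite (reindex_inj invg_inj); apply: eq_big => [p|p _]; first by rewrite /= groupV.
rewrite chiV; congr (_ * _%:R); congr (nat_of_bool _).
by apply/eqP/eqP => <-; rewrite word_actM ?mulgV ?mulVg word_act1.
Qed.

(** For a multiplicative [chi], the sum over G is |G| times an idempotent, each product p q being
    hit |G| times. *)
Lemma average_mx_sq G chi : (forall p q, chi (p * q)%g = chi p * chi q) ->
  average_mx G chi *m average_mx G chi = #|G|%:R *: average_mx G chi.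
Proof.
move=> chiM; apply/matrixP => a b; rewrite !mxE.
transitivity (\sum_(p in G) \sum_(q in G)
    chi p * chi q * (word_act (word_act (enum_val a) p) q == enum_val b)%:R).
  under eq_bigr do rewrite !mxE mulr_suml.
  rewrite exchange_big; apply: eq_bigr => p _ /=.
  rewrite (bigD1 (enum_rank (word_act (enum_val a) p))) //= enum_rankK eqxx mulr1.
  rewrite [X in _ + X]big1 ?addr0 => [|c cp].
    by rewrite mulr_sumr; apply: eq_bigr => q _; rewrite mulrA.
  rewrite [X in _ * X * _](_ : _ = 0) ?mulr0 ?mul0r //.
  case: eqP => // cE; by rewrite cE enum_valK eqxx in cp.
rewrite mulr_natl -sumr_const; apply: eq_bigr => p pG.
rewrite [RHS](reindex_inj (mulIg p)) /=; apply: eq_big => [q|q _].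
  by rewrite groupMr.
by rewrite word_actM chiM [chi p * _]mulrC.
Qed.

Variables (RG CG : {group {perm X}}).
Hypothesis P_row : forall r, r \in RG -> forall i, P (word_act i r) = P i.

Definition antisym_word i : V := \sum_(c in CG) (-1) ^+ c *: P (word_act i c).
Definition young_word i : V := \sum_(r in RG) antisym_word (word_act i r).

(* With Y the antisymmetrizer times the row symmetrizer, Y^T Y is proportional
   to row symmetrizer * antisymmetrizer * row symmetrizer, and Y lies in the
   row space of Y^T Y. *)
Lemma antisym_word_span i : lspan (fun v => exists j, v = young_word j) (antisym_word i).
Proof.
pose C := average_mx CG (fun c => (-1) ^+ c); pose Rm := average_mx RG (fun=> 1).
have CT : C^T = C by apply: tr_average_mx => c; rewrite odd_permV.
have RT : Rm^T = Rm by apply: tr_average_mx.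
have CC : C *m C = #|CG|%:R *: C.
  by apply: average_mx_sq => p q; rewrite odd_permM signr_addb.
have antisymE : mx_apply C P =1 antisym_word by move=> j; rewrite average_mxE.
have youngE : mx_apply (Rm *m C) P =1 young_word.
  move=> j; rewrite mx_applyM average_mxE; apply: eq_bigr => r _.
  by rewrite scale1r antisymE.
have rowE : mx_apply Rm P =1 (fun j => #|RG|%:R *: P j).
  move=> j; rewrite average_mxE scaler_nat -sumr_const.
  by apply: eq_bigr => r rR; rewrite scale1r P_row.
have [D DE] : exists D, C *m Rm = D *m ((C *m Rm)^T *m (C *m Rm)).
  apply/submxP/real_mx_sub_gram => a b; rewrite mxE.
  apply: rpred_sum => c _; rewrite !mxE; apply: rpredM; apply: rpred_sum => p _.
    by rewrite rpredM ?realn // rpredX // rpredN rpred1.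
  by rewrite mul1r realn.
have R0 : #|RG|%:R != 0 :> K by rewrite pnatr_eq0 -lt0n cardG_gt0.
(* Apply [DE] to [P], on which [Rm] acts as the scalar |RG|, and cancel |RG|. *)
have -> : antisym_word i =
    #|CG|%:R *: mx_apply D young_word i.
  apply: (scalerI R0).
  transitivity (mx_apply (C *m Rm) P i).
    by rewrite mx_applyM (eq_mx_apply _ _ rowE) mx_applyZ antisymE.
  have RCCR : Rm *m C *m (C *m Rm) = #|CG|%:R *: (Rm *m C *m Rm).
    by rewrite -mulmxA (mulmxA C) CC -scalemxAl -scalemxAr mulmxA.
  rewrite DE trmx_mul CT RT RCCR -scalemxAr mx_apply_scale.
  rewrite [RHS]scalerA mulrC -[RHS]scalerA.
  congr (_ *: _); rewrite mx_applyM -mx_applyZ; apply: eq_mx_apply => j.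
  by rewrite mx_applyM (eq_mx_apply _ _ rowE) mx_applyZ youngE.
apply: lspanZ; apply: lspan_sum => j _.
by apply: lspanZ; apply: lspanW; exists j.
Qed.

End Symmetrizer.

Lemma level_group_set (X : finType) (T : eqType) (u : X -> T) :
  group_set [set c : {perm X} | [forall x, u (c x) == u x]].
Proof.
apply/group_setP; split=> [|c c']; first by rewrite inE; apply/forallP => x; rewrite perm1.
rewrite !inE => /forallP cu /forallP c'u; apply/forallP => x.
by rewrite permM (eqP (c'u _)) cu.
Qed.

Canonical row_group_group n (m : n.-tuple nat) := Group (level_group_set (@brow n m)).
Canonical col_group_group n (m : n.-tuple nat) := Group (level_group_set (@bcol n m)).

Section YoungColumns.
Variables (K : numClosedFieldType) (n : nat) (m : n.-tuple nat) (s : 'I_3).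

(** Reindexing the boxes moves the row permutation from the upper to the lower indices. *)
Lemma young_col_antisym (i : box m -> 'I_n) :
  young K s i = \sum_(r in row_group m) col_antisym K s (fun x => i (r x)).
Proof.
rewrite /young [RHS](reindex_inj invg_inj); apply: eq_big => [r|r _].
  by rewrite [RHS](groupV (row_group_group m)).
apply: eq_bigr => c _; congr (_ * _).
rewrite [RHS](reindex_inj (@perm_inj _ r)); apply: eq_bigr => x _.
by rewrite permK.
Qed.

(** [antisym_word_span] applies to the monomials [P k]: a row permutation preserves the upper
    indices, so it only reorders the factors. *)
Lemma col_antisym_young (i : {ffun box m -> 'I_n}) :
  lspan (fun v => exists j : {ffun box m -> 'I_n}, v = young K s j) (col_antisym K s i).
Proof.
pose P (k : {ffun box m -> 'I_n}) : fpoly K n := \prod_x mel K s (k x) (brow x).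
have P_row r : r \in row_group_group m -> forall k, P (word_act k r) = P k.
  rewrite inE => /forallP rr k; rewrite [RHS](reindex_inj (@perm_inj _ r)).
  by apply: eq_bigr => x _; rewrite ffunE (eqP (rr x)).
have antisymE (k : {ffun box m -> 'I_n}) :
    col_antisym K s k = antisym_word P (col_group_group m) k.
  rewrite /antisym_word (reindex_inj invg_inj) /=; apply: eq_big => [c|c _].
    by rewrite [RHS](groupV (col_group_group m)).
  rewrite odd_permV -[RHS]mul_mpolyC rmorph_sign; congr (_ * _).
  rewrite [RHS](reindex_inj (@perm_inj _ c)); apply: eq_bigr => x _.
  by rewrite ffunE permK.
rewrite antisymE.
apply: (lspan_trans _ (antisym_word_span (col_group_group m) P_row i)).
move=> _ [j ->]; apply: lspanW; exists j.
rewrite young_col_antisym; apply: eq_bigr => r _; rewrite -antisymE.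
by apply: eq_col_antisym => x; rewrite ffunE.
Qed.

End YoungColumns.

(** * The tensor product and the spanning theorem *)

Lemma lspanM (K : nzRingType) (A : algType K) (P Q S : A -> Prop) (f g : A) :
    (forall a b, P a -> Q b -> lspan S (a * b)) ->
  lspan P f -> lspan Q g -> lspan S (f * g).
Proof.
move=> PQ Pf Qg; elim: Pf => [|c a f' Pa _ IH]; first by rewrite mul0r; apply: lspan0.
rewrite mulrDl -scalerAl; apply: lspanD IH; apply: lspanZ.
elim: Qg => [|d b g' Qb _ IH]; first by rewrite mulr0; apply: lspan0.
by rewrite mulrDr -scalerAr; apply: lspanD IH; apply/lspanZ/PQ.
Qed.

Section Tensor.
Variables (K : numClosedFieldType) (n : nat).
Hypothesis n_gt0 : (0 < n)%N.

Lemma young_irrep s (m : n.-tuple nat) (i : box m -> 'I_n) :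
  sorted geq m -> in_irrep s m (young K s i).
Proof.
move=> m_sorted; apply: (@in_irrep_span _ _ _ _ (in_irrep s m)) => //.
rewrite young_col_antisym; apply: lspan_sum => r _; apply: lspanW.
exact: col_antisym_irrep.
Qed.

Lemma in_irrep_young s (m : n.-tuple nat) (f : fpoly K n) :
    sorted geq m -> in_irrep s m f ->
  lspan (fun v => exists j : {ffun box m -> 'I_n}, v = young K s j) f.
Proof.
move=> m_sorted /(in_irrep_cols n_gt0 m_sorted); apply: lspan_trans => _ [i ->].
exact: col_antisym_young.
Qed.

Variables m M m' : n.-tuple nat.
Hypotheses (m_sorted : sorted geq m) (M_sorted : sorted geq M).
Hypothesis m'_sorted : sorted geq m'.

Lemma in_tensor_young3 (p : fpoly K n) : in_tensor m M m' p ->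
  exists tau : {ffun factor m M m' -> 'I_n} -> K, p = \sum_k tau k *: young3 K k.
Proof.
case=> N [f [g [h [fgh ->]]]].
suff : lspan (fun v => exists k : {ffun factor m M m' -> 'I_n}, v = young3 K k)
    (\sum_(t < N) f t * g t * h t).
  elim=> [|c _ w [k ->] _ [tau ->]].
    by exists (fun=> 0); rewrite big1 // => k _; rewrite scale0r.
  exists (fun k' => c *+ (k' == k) + tau k').
  under [RHS]eq_bigr do rewrite scalerDl.
  rewrite big_split; congr (_ + _).
  rewrite (bigD1 k) //= eqxx mulr1n [X in _ = _ + X]big1 ?addr0 //.
  by move=> k' /negbTE ->; rewrite scale0r.
apply: lspan_sum => t _; have [ft gt ht] := fgh t.
pose is_young2 v := exists (i : {ffun box m -> 'I_n}) (j : {ffun box M -> 'I_n}),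
  v = young K sa i * young K sb j.
apply: (lspanM (P := is_young2)) (in_irrep_young m'_sorted ht).
  move=> _ _ [i [j ->]] [l ->]; apply: lspanW.
  exists [ffun x => match x with
    inl (inl y) => i y | inl (inr y) => j y | inr y => l y end].
  by congr (_ * _ * _); apply: eq_young => x; rewrite ffunE.
apply: lspanM (in_irrep_young m_sorted ft) (in_irrep_young M_sorted gt).
by move=> _ _ [i ->] [j ->]; apply: lspanW; exists i, j.
Qed.

Lemma constructed_in_tensor (p : fpoly K n) :
  constructed m M m' p -> in_tensor m M m' p.
Proof.
case=> d [g [l [_ _ ->]]]; pose sigma := {ffun 'I_d -> 'S_n}.
pose i (t : 'I_#|{: sigma}|) f := enum_val t (g f) (l f).
(* One summand for each family of permutations, its sign absorbed into the factor in a. *)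
exists #|{: sigma}|,
  (fun t => family_sign K (enum_val t) *: young K sa (fun x => i t (inl (inl x)))),
  (fun t => young K sb (fun x => i t (inl (inr x)))),
  (fun t => young K sc (fun x => i t (inr x))).
split=> [t|].
  by split; [apply: in_irrepZ; apply: young_irrep|exact: young_irrep|exact: young_irrep].
rewrite (reindex (@enum_val sigma xpredT)) /=; last exact/onW_bij/enum_val_bij.
by apply: eq_bigr => t _; rewrite sign_scale -!scalerAl.
Qed.

End Tensor.

Theorem theorem3 (R : realType) (n : nat) (hn : (0 < n)%N)
    (m M m' : n.-tuple nat)
    (hm : sorted geq m) (hM : sorted geq M) (hm' : sorted geq m') :
  (forall q : fpoly R[i] n, constructed m M m' q ->
     in_tensor m M m' q /\ (q = 0 \/ semi_invariant q)) /\
  (forall p : fpoly R[i] n, in_tensor m M m' p -> semi_invariant p ->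
     exists (N : nat) (c : 'I_N -> R[i]) (q : 'I_N -> fpoly R[i] n),
       (forall t, constructed m M m' (q t) /\ semi_invariant (q t)) /\
       p = \sum_(t < N) c t *: q t).
Proof.
split=> [q qc|p p_tensor p_si].
  by split; [exact: constructed_in_tensor | exact: constructed_semi_invariant qc].
have [tau pE] := in_tensor_young3 hn hm hM hm' p_tensor.
suff : lspan (fun q => constructed m M m' q /\ semi_invariant q) p by exact: lspanP.
apply: (lspan_trans _ (semi_invariant_bracket hn pE p_si)) => q qc.
(* An overlay may vanish; such terms are dropped, as a semi-invariant is nonzero by definition. *)
have [->|q_si] := constructed_semi_invariant qc; first exact: lspan0.
exact: lspanW.
Qed.
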